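(* Let $M$ be a nonstandard model of the superstructure $\mathcal{S}$ over $\mathbf{R}$ and let $\varepsilon\in{}^*\mathbf{R}$ be a positive infinitesimal. Let $x_i=(\rho_i,\varphi_i)\in Y$, $i=1,2$, be two points of the finite part $Y$ of the rescaled nonstandard Lobachevsky plane $({}^*H,\varepsilon\cdot{}^*d)$, and set $\lambda_i=\lambda(e^{-\rho_i})\in\Lambda$. Then $$\operatorname{st}\bigl(\varepsilon\cdot{}^*d(x_1,x_2)\bigr)=\delta\bigl((f_{\varphi_1},\lambda_1),(f_{\varphi_2},\lambda_2)\bigr),$$ where $f_{\varphi_i}$ is regarded as a function on $\{\lambda\in\Lambda:\lambda_i\le\lambda\le\lambda^0\}$.
   Context: Models. Let $S_0=\mathbf{R}$ (treated as individuals), $S_{i+1}=S_i\cup\mathcal{P}(S_i)$ and $\mathcal{S}=\bigcup_{i}S_i$ (the superstructure). Consider bounded first-order formulas (every variable ranges over some entity, i.e. over some element of $\mathcal{S}\setminus S_0$) in the language with $=$, $\in$ and a constant for each element of $\mathcal{S}$. A nonstandard model $M$ of $\mathcal{S}$ is a structure containing $\mathcal{S}$ via an injection $x\mapsto{}^*x$, with relations extending $=$ and $\in$, in which exactly the bounded sentences true in $\mathcal{S}$ are true (transfer), and such that ${}^*\mathbf{R}$ is a proper extension of $\mathbf{R}$. A number $a\in{}^*\mathbf{R}$ is finite if $|a|<K$ for some $K\in\mathbf{R}$; its standard part $\operatorname{st}(a)\in\mathbf{R}$ is the unique real infinitely close to $a$. Decomposition. Fix a well-ordering $\prec$ of ${}^*\mathbf{R}$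 given by a bijection with the least ordinal of cardinality $|{}^*\mathbf{R}|$. For nonzero $x,y\in{}^*\mathbf{R}$ write $x\sim y$ if both $x/y$ and $y/x$ are finite. Let $\Lambda=({}^*\mathbf{R}\setminus\{0\})/{\sim}$, let $\lambda(x)$ be the class of $x$, and order $\Lambda$ by: $\lambda(x)<\lambda(y)$ iff $\lambda(x)\ne\lambda(y)$ and $|x|<|y|$. Let $\lambda^0=\lambda(1)$ (finite non-infinitesimal numbers), $a_{\lambda^0}=1$, and for $\lambda\neq\lambda^0$ let $a_\lambda$ be the $\prec$-minimal element of $\lambda$. For every $x\in{}^*\mathbf{R}$ define by transfinite recursion: $x_0=x$; if $x_i=0$ the process stops and $\alpha(x):=i$; if $x_i\ne0$, put $\lambda_i=\lambda(x_i)$, $c_i=\operatorname{st}(x_i/a_{\lambda_i})\neq0$, $x_{i+1}=x_i-c_ia_{\lambda_i}$; if $\alpha$ is a limit ordinal and the process has not stopped before $\alpha$, put $x_\alpha=x-a$, where $a$ is the $\prec$-minimal element of the set of all $y\in{}^*\mathbf{R}$ whose process does not stop before $\alpha$ and yields the same $(c_\beta,\lambda_\beta)$ for all $\beta<\alpha$. The $\lambda_i$ strictly decrease, so the process stops. Put $\operatorname{spec}(x)=\{\lambda_i:i<\alpha(x)\}$, $f_x(\lambda_i)=c_i$, and $f_x(\lambda)=0$ for $\lambda\notin\operatorname{spec}(x)$. Circle. A point $\varphi\in{}^*S^1={}^*\mathbf{R}/2\pi{}^*\mathbf{Z}$ has a unique representative $\tilde\varphi\in{}^*\mathbf{R}$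 that is finite with $\operatorname{st}(\tilde\varphi)\in[0,2\pi)$. Put $f_\varphi=f_{\tilde\varphi}$; thus $f_\varphi(\lambda)=0$ for $\lambda>\lambda^0$, and $f_\varphi(\lambda^0)\in[0,2\pi)$ is regarded as an element of $S^1$. Plane. The Lobachevsky plane $\mathcal{H}=(H,d)$ (curvature $-1$) is described in polar coordinates $(\rho,\varphi)$, $\rho\ge0$ (the distance to the origin), $\varphi\in S^1$, by $\cosh d(x_1,x_2)=\cosh\rho_1\cosh\rho_2-\sinh\rho_1\sinh\rho_2\cos(\varphi_1-\varphi_2)$. Its nonstandard extension is $({}^*H,{}^*d)$, with $\rho\in{}^*\mathbf{R}$, $\rho\ge0$, $\varphi\in{}^*S^1$. The finite part is $Y=\{(\rho,\varphi)\in{}^*H:\varepsilon\rho\text{ is finite}\}$. The functions $g$ and $\delta$. For $\lambda\in\Lambda$, $\lambda\le\lambda^0$, let $g(\lambda)=\operatorname{st}(-\varepsilon\log|a_\lambda|)\in[0,\infty]$, with $g(\lambda)=+\infty$ if $-\varepsilon\log|a_\lambda|$ is infinite. For $\lambda_1,\lambda_2\le\lambda^0$ with $g(\lambda_i)<\infty$ and functions $f_i$ on $\{\lambda:\lambda_i\le\lambda\le\lambda^0\}$ put $$\delta((f_1,\lambda_1),(f_2,\lambda_2))=(g(\lambda_1)-\tilde g)+(g(\lambda_2)-\tilde g),$$ $$\tilde g=\sup\{h\in\mathbf{R}: f_1(\lambda)=f_2(\lambda)\text{ for all }\lambda\le\lambda^0\text{ such that }g(\lambda)<h\},$$ where ''$f_1(\lambda)=f_2(\lambda)$''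 means that both are defined at $\lambda$ and equal (so $\tilde g\le\min(g(\lambda_1),g(\lambda_2))$). *)

(* Defs.v *)
From HB Require Import structures.
From mathcomp Require Import all_boot all_order all_algebra.
From mathcomp Require Import all_classical all_reals all_analysis.
From mathcomp Require wochoice.

Set Implicit Arguments.
Unset Strict Implicit.
Unset Printing Implicit Defensive.

Import Order.TTheory GRing.Theory Num.Theory.
Local Open Scope classical_set_scope.
Local Open Scope ring_scope.

(* Since S_(n+1) = S_n `|` P(S_n), an element of S_(n+1) is either an individual
   or a subset of S_n: [code R n] enumerates S_n, with repetitions. *)
Fixpoint code (R : Type) (n : nat) : Type :=
  if n is m.+1 then (R + set (code R m))%type else R.

Definition view (R : Type) (n : nat) :
    code R n -> R + {m : nat & set (code R m)} :=
  match n with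
  | 0 => fun r => inl r
  | m.+1 => fun x =>
      match x with
      | inl r => inl r
      | inr A => inr (existT (fun k => set (code R k)) m A)
      end
  end.

(* [same x y]: the codes x and y denote the same individual or the same set. *)
Fixpoint same (R : Type) (m : nat) : code R m -> forall n, code R n -> Prop :=
  match m with
  | 0 => fun r n y => if view y is inl s then r = s else False
  | k.+1 => fun x n y =>
      match x, view y with
      | inl r, inl s => r = s
      | inr A, inr (existT l B) =>
          (forall a, A a -> exists2 b, B b & same a b) /\
          (forall b, B b -> exists2 a, A a & same a b)
      | _, _ => False
      end
  end.

(* The direct limit: an element of the superstructure is the set of all its
   codes, so that Coq's equality is the equality of the superstructure. *)
Record superstructure (R : Type) := Super {
  codes_of : set {n : nat & code R n};
  codes_ofP : exists n (x : code R n), codes_of = [set y | same x (tagged y)] }.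

Definition decode (R : Type) (n : nat) (x : code R n) : superstructure R :=
  Super (ex_intro _ n (ex_intro _ x erefl)).

Definition smem (R : Type) (X Y : superstructure R) : Prop :=
  exists x y, [/\ codes_of X x, codes_of Y y &
    if view (tagged y) is inr (existT k B)
    then exists2 b, B b & same (tagged x) b else False].

Definition ind (R : Type) (r : R) : superstructure R := decode (n := 0) r.

Definition entity (R : Type) (X : superstructure R) : Prop :=
  ~ exists r, X = ind r.

Definition stratum (R : Type) (n : nat) : set (superstructure R) :=
  range (@decode R n).

(* The set of all X in S_n such that P X. *)
Definition sep (R : Type) (n : nat) (P : set (superstructure R)) :
    superstructure R :=
  @decode R n.+1 (inr [set x | P (decode x)]).

(* S_n as an element of the superstructure; [sstratum R 0] is the set R. *)
Definition sstratum (R : Type) (n : nat) : superstructure R := sep n setT.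

(** The following facts characterize the superstructure up to isomorphism. *)

Section SuperstructureTheory.
Context {R : Type}.

Lemma sameE m (x : code R m) n (y : code R n) :
  same x y = match view x, view y with
             | inl r, inl s => r = s
             | inr (existT _ A), inr (existT _ B) =>
                 (forall a, A a -> exists2 b, B b & same a b) /\
                 (forall b, B b -> exists2 a, A a & same a b)
             | _, _ => False
             end.
Proof. by case: m x => [r|m [r|A]] //=; case: view => //; case. Qed.

Lemma same_refl m (x : code R m) : same x x.
Proof. by elim: m x => [//|m IH] [//|A] /=; split=> a Aa; exists a. Qed.

Lemma same_sym m (x : code R m) n (y : code R n) : same x y -> same y x.
Proof.
elim: m x n y => [r|m IH [r|A]] n y; rewrite sameE (sameE y) /=.
- by case: view => // -[].
- by case: view => // -[].
case: view => // -[k B] [AB BA]; split=> [b /BA[a Aa ab]|a /AB[b Bb ab]].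
  by exists a => //; apply: IH.
by exists b => //; apply: IH.
Qed.

Lemma same_trans m (x : code R m) n (y : code R n) p (z : code R p) :
  same x y -> same y z -> same x z.
Proof.
elim: m x n y p z => [r|m IH [r|A]] n y p z;
  rewrite sameE (sameE y) (sameE _ z) /=.
- by case: (view y) => [s -> //|[] //].
- by case: (view y) => [s -> //|[] //].
case: (view y) => // -[k B] [AB BA]; case: view => // -[l C] [BC CB].
split=> [a /AB[b /BC[c Cc bc] ab]|c /CB[b /BA[a Aa ab] bc]].
  by exists c => //; apply: IH bc.
by exists a => //; apply: IH bc.
Qed.

Lemma codes_of_inj : injective (@codes_of R).
Proof.
case=> C pC [D pD] /= CD; case: _ / CD in pD *.
by congr Super; exact: Prop_irrelevance.
Qed.

Lemma decode_eq m (x : code R m) n (y : code R n) :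
  decode x = decode y <-> same x y.
Proof.
split=> [[xy]|xy].
  suff: [set y : {n : nat & code R n} | same x (tagged y)] (Tagged _ y) by [].
  by rewrite xy; exact: same_refl.
apply/codes_of_inj/seteqP; split=> z /= h; last exact: same_trans h.
by apply: same_trans h; apply: same_sym.
Qed.

Lemma decode_surj (X : superstructure R) : exists n (x : code R n), X = decode x.
Proof. by case: (X) => C [n [x xC]]; exists n, x; exact: codes_of_inj. Qed.

Lemma ind_inj : injective (@ind R).
Proof. by move=> r s /decode_eq. Qed.

Lemma smem_decode m (x : code R m) n (y : code R n) :
  smem (decode x) (decode y) <->
  if view y is inr (existT k B) then exists2 b, B b & same x b else False.
Proof.
split=> [[[p x'] [[q y'] [/= xx' yy']]]|h]; last first.
  by exists (Tagged _ x), (Tagged _ y); split=> //; exact: same_refl.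
move: yy'; rewrite sameE; case: (view y) (view y') => [r|[k B]] [s|[l C]] //.
move=> [BC CB] [c /CB[b Bb bc] x'c]; exists b => //.
by apply: same_trans xx' _; apply: same_trans x'c _; exact: same_sym.
Qed.

Lemma smem_ind (X : superstructure R) r : ~ smem X (ind r).
Proof. by have [n [x ->]] := decode_surj X; move/smem_decode. Qed.

Lemma smem_sep n P (X : superstructure R) :
  smem X (sep n P) <-> stratum n X /\ P X.
Proof.
have [m [x ->]] := decode_surj X; split=> [/smem_decode /= [b Pb /decode_eq ->]|].
  by split=> //; exists b.
by case=> -[b _ <-] Pb; apply/smem_decode; exists b => //; exact: same_refl.
Qed.

Lemma entity_sep n (P : set (superstructure R)) : entity (sep n P).
Proof. by case=> r /decode_eq. Qed.

Lemma superstructure_ext (X Y : superstructure R) :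
  entity X -> entity Y -> (forall Z, smem Z X <-> smem Z Y) -> X = Y.
Proof.
have [m [x ->]] := decode_surj X; have [n [y ->]] := decode_surj Y.
move=> eX eY XY; apply/decode_eq; rewrite sameE.
case vx : (view x) => [r|[k A]].
  by exfalso; apply: eX; exists r; apply/decode_eq; rewrite sameE vx.
case vy : (view y) => [r|[l B]].
  by exfalso; apply: eY; exists r; apply/decode_eq; rewrite sameE vy.
split=> [a Aa|b Bb].
  have /XY/smem_decode : smem (decode a) (decode x).
    by apply/smem_decode; rewrite vx; exists a => //; exact: same_refl.
  by rewrite vy.
have /XY/smem_decode : smem (decode b) (decode y).
  by apply/smem_decode; rewrite vy; exists b => //; exact: same_refl.
by rewrite vx => -[a Aa ba]; exists a => //; exact: same_sym.
Qed.

Lemma stratum0 : stratum 0 = range (@ind R).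
Proof. by []. Qed.

Lemma stratumS n : stratum n.+1 =
  stratum n `|`
  [set X : superstructure R | entity X /\ (forall Z, smem Z X -> stratum n Z)].
Proof.
have ind_stratum r k : @stratum R k (ind r).
  by case: k => [|k]; [exists r | exists (inl r) => //; apply/decode_eq].
apply/seteqP; split=> X.
  move=> [[r|A] _ <-].
    by left; have -> : @decode R n.+1 (inl r) = ind r by exact/decode_eq.
  right; split=> [[r /decode_eq //]|Z].
  have [m [z ->]] := decode_surj Z.
  by move=> /smem_decode[b _ /decode_eq ->]; exists b.
case=> [|[eX Xn]].
  elim: n X => [|n IH] X [x _ <-]; first exact: ind_stratum.
  case: x => [r|A].
    by have -> : @decode R n.+1 (inl r) = ind r; [exact/decode_eq|].
  pose B : set (code R n.+1) := [set b | exists2 a, A a & decode b = decode a].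
  exists (inr B) => //; apply/decode_eq; split=> [b [a Aa /decode_eq ba]|a Aa].
    by exists a.
  have [b _ ba] : stratum n.+1 (decode a) by apply: IH; exists a.
  by exists b; [exists a|apply/decode_eq].
have <- : sep n (fun Z => smem Z X) = X.
  apply: superstructure_ext => // [|Z]; first exact: entity_sep.
  by rewrite smem_sep; split=> [[]//|ZX]; split=> //; exact: Xn.
by exists (inr [set x : code R n | smem (decode x) X]).
Qed.

Lemma stratum_bigcup : \bigcup_n stratum n = [set: superstructure R].
Proof.
apply/seteqP; split=> X // _; have [n [x ->]] := decode_surj X.
by exists n => //; exists x.
Qed.

End SuperstructureTheory.

(* V is the type of free variables; a quantifier adds one, called [None]. *)
Inductive term (S V : Type) := Var of V | Cst of S.

Inductive formula (R V : Type) :=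
  | Eq of term (superstructure R) V & term (superstructure R) V
  | In of term (superstructure R) V & term (superstructure R) V
  | Not of formula R V
  | And of formula R V & formula R V
  | Or of formula R V & formula R V
  | Imp of formula R V & formula R V
  | All (X : superstructure R) of entity X & formula R (option V)
  | Ex (X : superstructure R) of entity X & formula R (option V).

Definition sentence (R : Type) := formula R void.

Definition eval (S A V : Type) (int : S -> A) (e : V -> A) (t : term S V) : A :=
  match t with Var v => e v | Cst c => int c end.

Fixpoint sat (R A : Type) (mem : A -> A -> Prop) (int : superstructure R -> A)
    (V : Type) (e : V -> A) (phi : formula R V) : Prop :=
  match phi with
  | Eq s t => eval int e s = eval int e t
  | In s t => mem (eval int e s) (eval int e t)
  | Not p => ~ sat mem int e p
  | And p q => sat mem int e p /\ sat mem int e q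
  | Or p q => sat mem int e p \/ sat mem int e q
  | Imp p q => sat mem int e p -> sat mem int e q
  | All X _ p => forall a, mem a (int X) -> sat mem int (oapp e a) p
  | Ex X _ p => exists2 a, mem a (int X) & sat mem int (oapp e a) p
  end.

Definition holds (R A : Type) (mem : A -> A -> Prop)
    (int : superstructure R -> A) (phi : sentence R) : Prop :=
  sat mem int (of_void A) phi.

Record nonstandard_model (R : Type) := NonstandardModel {
  carrier : Type;
  nmem : carrier -> carrier -> Prop;
  star : superstructure R -> carrier;
  star_inj : injective star;
  star_mem : forall X Y, nmem (star X) (star Y) <-> smem X Y;
  transfer : forall phi : sentence R,
    holds (@smem R) id phi <-> holds nmem star phi;
  proper : exists2 a, nmem a (star (sstratum R 0)) &
    forall r : R, a <> star (ind r) }.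

Record hyperreal (R : Type) (M : nonstandard_model R) := Hyperreal {
  hval : carrier M;
  hvalP : nmem hval (star M (sstratum R 0)) }.

HB.instance Definition _ (R : Type) (M : nonstandard_model R) :=
  gen_eqMixin (hyperreal M).
HB.instance Definition _ (R : Type) (M : nonstandard_model R) :=
  gen_choiceMixin (hyperreal M).

Lemma smem_ind_R (R : Type) (r : R) : smem (ind r) (sstratum R 0).
Proof. by apply/smem_sep; split=> //; exists r. Qed.

Definition hstd (R : Type) (M : nonstandard_model R) (r : R) : hyperreal M :=
  Hyperreal (proj2 (star_mem M (ind r) (sstratum R 0)) (smem_ind_R r)).

(* Kuratowski pairs and tuples (x, (y, (z, t))), written with quantifiers bounded
   by b, so that they make sense both in the superstructure (with b = S_k) and
   in a model (with b the extension of S_k). *)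
Section Tuples.
Context {A : Type} (mem : A -> A -> Prop) (b : A).

Definition is_upair (u x y : A) : Prop :=
  forall v, mem v b -> (mem v u <-> v = x \/ v = y).

Definition is_pair (p x y : A) : Prop :=
  exists u v, [/\ mem u b, mem v b, is_upair u x x, is_upair v x y &
                  is_upair p u v].

Fixpoint is_tuple (p : A) (s : seq A) : Prop :=
  match s with
  | [::] => False
  | [:: x] => p = x
  | x :: s' => exists q, [/\ mem q b, is_tuple q s' & is_pair p x q]
  end.

End Tuples.

(* The n-tuples of reals satisfying P, for n > 0: all the sets involved in the
   coding of an n-tuple belong to S_(2n). *)
Definition graph (R : Type) (n : nat) (P : set (seq R)) : superstructure R :=
  sep n.*2 [set p | exists s, [/\ size s = n, P s &
    is_tuple (@smem R) (sstratum R n.*2) p (map (@ind R) s)]].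

Section Extension.
Context {R : Type} (M : nonstandard_model R).

Definition hrel (P : set (seq R)) (s : seq (hyperreal M)) : Prop :=
  exists2 p, nmem p (star M (graph (size s) P)) &
    is_tuple (@nmem R M) (star M (sstratum R (size s).*2)) p
      (map (@hval R M) s).

Definition hfun1 (f : R -> R) (x : hyperreal M) : hyperreal M :=
  xget x [set y | hrel [set s | exists a, s = [:: a; f a]] [:: x; y]].

Definition hfun2 (f : R -> R -> R) (x y : hyperreal M) : hyperreal M :=
  xget x [set z | hrel [set s | exists a b, s = [:: a; b; f a b]]
                       [:: x; y; z]].

Definition hfun4 (f : R -> R -> R -> R -> R) (x y z t : hyperreal M) :
    hyperreal M :=
  xget x [set u | hrel
    [set s | exists a b c d, s = [:: a; b; c; d; f a b c d]]
    [:: x; y; z; t; u]].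

End Extension.

Section Hyperreals.
Context {R : realType} {M : nonstandard_model R}.
Local Notation hR := (hyperreal M).
Implicit Types x y : hR.

Definition hadd : hR -> hR -> hR := hfun2 (fun a b => a + b).
Definition hsub : hR -> hR -> hR := hfun2 (fun a b => a - b).
Definition hmul : hR -> hR -> hR := hfun2 (fun a b => a * b).
Definition hdiv : hR -> hR -> hR := hfun2 (fun a b => a / b).
Definition hopp : hR -> hR := hfun1 (fun a => - a).
Definition habs : hR -> hR := hfun1 (fun a => `|a|).
Definition hexp : hR -> hR := hfun1 (fun a => expR a).
Definition hlog : hR -> hR := hfun1 (fun a => ln a).
Definition hlt x y : Prop :=
  hrel [set s | exists a b : R, s = [:: a; b] /\ a < b] [:: x; y].
Definition hle x y : Prop :=
  hrel [set s | exists a b : R, s = [:: a; b] /\ a <= b] [:: x; y].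
Definition hint x : Prop := hrel [set s | exists k : int, s = [:: k%:~R]] [:: x].

Definition hzero : hR := hstd M 0.
Definition hone : hR := hstd M 1.

Definition hfinite x : Prop := exists K : R, hlt (habs x) (hstd M K).
Definition infinitesimal x : Prop :=
  forall e : R, 0 < e -> hlt (habs x) (hstd M e).

Definition st x : R := xget 0 [set r : R | infinitesimal (hsub x (hstd M r))].

Definition arch_equiv x y : Prop := hfinite (hdiv x y) /\ hfinite (hdiv y x).

(* Elements of Lambda are represented by subsets of *R. *)
Definition lam x : set hR := [set y | y <> hzero /\ arch_equiv x y].
Definition Lambda : set (set hR) := [set l | exists2 x, x <> hzero & l = lam x].

Definition lam_lt (l m : set hR) : Prop :=
  l <> m /\ exists x y, [/\ l x, m y & hlt (habs x) (habs y)].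
Definition lam_le (l m : set hR) : Prop := l = m \/ lam_lt l m.

Definition lam0 : set hR := lam hone.

End Hyperreals.

(* R is a well-ordering of T whose order type is the least among those of all
   well-orderings of T, that is, the least ordinal of cardinality |T|: every
   other one has an initial segment isomorphic to it. *)
Definition initial_well_order (T : Type) (R : rel T) : Prop :=
  wochoice.well_order R /\
  forall Q : rel T, wochoice.well_order Q ->
    exists f : T -> T, {mono f : x y / R x y >-> Q x y} /\
      forall x z, Q z (f x) -> exists y, z = f y.

(* The strict part of a well-ordering. *)
Definition strict (W : Type) (Q : rel W) (j i : W) : Prop := ~~ Q i j.

Lemma strict_wf (W : Type) (Q : rel W) :
  wochoice.well_order Q -> well_founded (strict Q).
Proof.
move=> wQ i; apply: contrapT => ni.
have [|z [[/asboolP nz zmin] _]] := wQ [pred k | `[< ~ Acc (strict Q) k >]].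
  by exists i; apply/asboolP.
apply: nz; constructor => y; rewrite /strict; apply: contraNP => ny.
by apply: zmin; apply/asboolP.
Qed.

Section Decomposition.
Context {R : realType} {M : nonstandard_model R}.
Local Notation hR := (hyperreal M).
Variable prec : rel hR.
Implicit Types x y : hR.

Definition prec_min (P : set hR) : hR :=
  xget hzero [set a | P a /\ forall y, P y -> prec a y].

Definition rep_of (l : set hR) : hR :=
  if `[< l = lam0 >] then hone else prec_min l.

(* c_i and lambda_i, as functions of x_i. *)
Definition leading_coef x : R := st (hdiv x (rep_of (lam x))).
Definition lead x : R * set hR := (leading_coef x, lam x).

Definition remainder x : hR :=
  hsub x (hmul (hstd M (leading_coef x)) (rep_of (lam x))).

(* Ordinals are represented by the elements of arbitrary well-ordered types:
   i in W stands for the order type of {j | j < i}.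
   After the process has stopped, its value is frozen at 0, so that
   i < alpha(x) if and only if [stage prec wQ i x <> hzero]. *)
Definition stage_step (W : Type) (Q : rel W) (i : W)
    (X : forall j, strict Q j i -> hR -> hR) (x : hR) : hR :=
  if pselect (exists j (ji : strict Q j i), X j ji x = hzero) then hzero
  else if pselect (forall j, ~ strict Q j i) then x
  else match pselect (exists j, strict Q j i /\
                        forall k, strict Q k i -> ~ strict Q j k) with
       | left h => let j := cid h in remainder (X (sval j) (svalP j).1 x)
       | right _ => hsub x (prec_min [set y | forall j (ji : strict Q j i),
                      X j ji y <> hzero /\ lead (X j ji y) = lead (X j ji x)])
       end.

Definition stage (W : Type) (Q : rel W) (wQ : wochoice.well_order Q) :
    W -> hR -> hR :=
  Fix (strict_wf wQ) (fun _ => hR -> hR) (@stage_step W Q).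

Lemma stageE (W : Type) (Q : rel W) (wQ : wochoice.well_order Q) i :
  stage wQ i = stage_step (fun j (_ : strict Q j i) => stage wQ j).
Proof.
apply: (Fix_eq (strict_wf wQ) (fun _ => hR -> hR) (@stage_step W Q)).
move=> j X Y XY; have -> // : X = Y.
by apply: functional_extensionality_dep => k; apply/funext => h; exact: XY.
Qed.

(* f_x; by well-ordering, at most one c has the required property. *)
Definition coef x (l : set hR) : R :=
  xget 0 [set c | exists (W : Type) (Q : rel W) (wQ : wochoice.well_order Q)
    (i : W), stage wQ i x <> hzero /\ lead (stage wQ i x) = (c, l)].

End Decomposition.

Definition cosh (R : realType) (t : R) : R := (expR t + expR (- t)) / 2.
Definition sinh (R : realType) (t : R) : R := (expR t - expR (- t)) / 2.

Definition lobachevsky_dist (R : realType) (r1 t1 r2 t2 : R) : R :=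
  xget 0 [set d | 0 <= d /\
    cosh d = cosh r1 * cosh r2 - sinh r1 * sinh r2 * cos (t1 - t2)].

(* *S^1 = *R / 2 pi *Z: its points are cosets. *)
Record hcircle (R : realType) (M : nonstandard_model R) := HCircle {
  coset_of : set (hyperreal M);
  coset_ofP : exists x, coset_of =
    [set y | exists2 k, hint k & y = hadd x (hmul (hstd M (2 * pi)) k)] }.

Record hplane (R : realType) (M : nonstandard_model R) := HPlane {
  hradius : hyperreal M;
  hradius_ge0 : hle hzero hradius;
  hangle : hcircle M }.

Section Plane.
Context {R : realType} {M : nonstandard_model R}.
Local Notation hR := (hyperreal M).
Variables (prec : rel hR) (eps : hR).

Definition std_angle (phi : hcircle M) : hR :=
  xget hzero [set y | [/\ coset_of phi y, hfinite y & 0 <= st y < 2 * pi]].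

Definition circle_coef (phi : hcircle M) : set hR -> R :=
  coef prec (std_angle phi).

Definition hdist (p q : hplane M) : hR :=
  hfun4 (@lobachevsky_dist R) (hradius p) (std_angle (hangle p))
                              (hradius q) (std_angle (hangle q)).

Definition finite_part (p : hplane M) : Prop :=
  hfinite (hmul eps (hradius p)).

Definition g (l : set hR) : \bar R :=
  let a := hopp (hmul eps (hlog (habs (rep_of prec l)))) in
  if `[< hfinite a >] then (st a)%:E else +oo%E.

(* f1 and f2 are regarded as functions on the sets [l1, lambda^0] and
   [l2, lambda^0]: their values elsewhere are ignored. *)
Definition g_tilde (f1 : set hR -> R) (l1 : set hR)
    (f2 : set hR -> R) (l2 : set hR) : \bar R :=
  ereal_sup [set h%:E | h in [set h : R | forall l : set hR,
    Lambda l -> lam_le l lam0 -> (g l < h%:E)%E ->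
    [/\ lam_le l1 l, lam_le l2 l & f1 l = f2 l]]].

(* The values are finite when g l1 and g l2 are. *)
Definition delta (f1 : set hR -> R) (l1 : set hR)
    (f2 : set hR -> R) (l2 : set hR) : \bar R :=
  ((g l1 - g_tilde f1 l1 f2 l2) + (g l2 - g_tilde f1 l1 f2 l2))%E.

End Plane.

(* Main.v *)
(** Let D be the difference of the two angles. The process splits a hyperreal into
    leading terms of decreasing magnitude, so the processes of two numbers x, y
    agree exactly as long as the leading term is much larger than x - y, and
    f_x, f_y differ at the class of x - y. Hence, with [val z] for
    - eps log |z|, the gap g~ is the minimum m of st(eps rho_1), st(eps rho_2) and
    st(val D). On the other hand
    cosh d = cosh (rho_1 - rho_2) + 2 sinh rho_1 sinh rho_2 sin^2 (D / 2) gives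
    d = max(|rho_1 - rho_2|, rho_1 + rho_2 + 2 log |D|) up to a finite error, so
    that eps d has standard part st(eps rho_1) + st(eps rho_2) - 2 m.

    Transfer is applied to first-order formulas about reals built from arbitrary
    real functions and relations; these are translated into bounded formulas
    about the graphs of the functions. *)
From HB Require Import structures.
From mathcomp Require Import all_boot all_order all_algebra.
From mathcomp Require Import all_classical all_reals all_analysis.
From mathcomp Require Import zify ring lra.
From mathcomp Require wochoice.
Require Import Defs.

Set Implicit Arguments.
Unset Strict Implicit.
Unset Printing Implicit Defensive.

Import Order.TTheory GRing.Theory Num.Theory.
Local Open Scope classical_set_scope.
Local Open Scope ring_scope.

(** * Transfer *)

Section Tuples.
Context {R : Type}.
Local Notation mem := (@smem R).

(** Stages are indexed by elements of arbitrary well-ordered types, and a limit stage subtracts an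
    element known only as a minimum. Two facts make it unnecessary to know that element. While the
    leading terms of x and y coincide, the same element is subtracted from both, so the difference
    of their stages stays x - y. A stage depends only on the order type of the initial segment below
    its index. That f_x and f_y differ at the class of D = x - y is then a matter of signs: a common
    nonzero coefficient c would be the leading coefficient of x - y and, with x and y exchanged,
    that of y - x, so that c = - c.

    Classes determine a number only up to a finite factor, which eps log makes infinitesimal.
    Comparisons of [val] therefore carry an arbitrary standard margin eta, and classes whose value
    is exactly m do not affect the supremum.

    The representatives of the angles have standard part in [0, 2 pi), so |D| stays below a standard
    bound smaller than 2 pi. Hence sin (D / 2) is comparable to D, and D need not be reduced modulo
    2 pi. *)

Lemma smem_sstratum n (X : superstructure R) :
  smem X (sstratum R n) <-> stratum n X.
Proof. by split=> [/smem_sep[]|Xn] //; apply/smem_sep. Qed.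

Lemma stratum_le m n : (m <= n)%N -> @stratum R m `<=` @stratum R n.
Proof.
move=> /subnK <-; elim: (n - m)%N => [//|k IH] X /IH.
by rewrite addSn stratumS; left.
Qed.

Lemma stratum_ind n (r : R) : stratum n (ind r).
Proof. by apply: (stratum_le (leq0n n)); exists r. Qed.

Lemma stratum_sep n P : stratum n.+1 (@sep R n P).
Proof. by eexists. Qed.

(** The components must lie in S_N because [is_upair] tests only the candidate members inside S_N:
    each component is itself such a candidate, and testing all four of them decides the matching. *)
Lemma is_upair_inj N p u v u' v' :
  stratum N u -> stratum N v -> stratum N u' -> stratum N v' ->
  is_upair mem (sstratum R N) p u v -> is_upair mem (sstratum R N) p u' v' ->
  (u = u' /\ v = v') \/ (u = v' /\ v = u').
Proof.
move=> /smem_sstratum uN /smem_sstratum vN /smem_sstratum u'N.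
move=> /smem_sstratum v'N H H'.
have : u = u' \/ u = v' by apply/(H' _ uN)/(H _ uN); left.
have : v = u' \/ v = v' by apply/(H' _ vN)/(H _ vN); right.
have : u' = u \/ u' = v by apply/(H _ u'N)/(H' _ u'N); left.
have : v' = u \/ v' = v by apply/(H _ v'N)/(H' _ v'N); right.
by case=> ?; case=> ?; case=> ?; case=> ?; subst; auto.
Qed.

Lemma is_pair_inj N p x y x' y' :
  stratum N x -> stratum N y -> stratum N x' -> stratum N y' ->
  is_pair mem (sstratum R N) p x y -> is_pair mem (sstratum R N) p x' y' ->
  x = x' /\ y = y'.
Proof.
move=> xN yN x'N y'N [u [v [uN vN ux vxy puv]]] [u' [v' [u'N v'N ux' vxy' puv']]].
move: uN vN u'N v'N => /smem_sstratum uN /smem_sstratum vN.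
move=> /smem_sstratum u'N /smem_sstratum v'N.
case: (is_upair_inj uN vN u'N v'N puv puv') => -[? ?]; subst.
  have [[? _]|[? _]] := is_upair_inj xN xN x'N x'N ux ux'; subst;
  by have [[? ?]|[? ?]] := is_upair_inj xN yN xN y'N vxy vxy'; subst.
have [[? ?]|[? ?]] := is_upair_inj xN xN x'N y'N ux vxy'; subst;
by have [[? ?]|[? ?]] := is_upair_inj xN yN x'N x'N vxy ux'; subst.
Qed.

Lemma is_tuple_inj N p (s s' : seq R) : size s = size s' ->
  is_tuple mem (sstratum R N) p (map (@ind R) s) ->
  is_tuple mem (sstratum R N) p (map (@ind R) s') ->
  stratum N p -> s = s'.
Proof.
elim: s p s' => [|x s IH] p [|x' s'] //= [ss'].
case: s s' ss' IH => [|y s] [|y' s'] //=.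
  by move=> _ _ -> e _; rewrite (ind_inj e).
move=> ss' IH [q [/smem_sstratum qN qs pq]] [q' [/smem_sstratum q'N q's' pq']] pN.
have xN := stratum_ind N x; have x'N := stratum_ind N x'.
have [xx' qq'] := is_pair_inj xN qN x'N q'N pq pq'.
by rewrite (ind_inj xx'); congr cons; apply: (IH q) => //; rewrite qq'.
Qed.

Lemma is_upair_sep N k u v : (k <= N)%N -> stratum k u -> stratum k v ->
  is_upair mem (sstratum R N) (sep k [set z | z = u \/ z = v]) u v.
Proof.
move=> kN uk vk z _; split=> [/smem_sep[]//|zuv]; apply/smem_sep; split=> //.
by case: zuv => ->.
Qed.

(** A Kuratowski pair of elements of S_k lies in S_(k+2), so each further component costs two
    strata. This is the origin of the doubling in [graph]. *)
Lemma is_tuple_exists N (x : R) s : ((size s).*2 <= N)%N ->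
  exists2 p, stratum (size s).*2 p &
    is_tuple mem (sstratum R N) p (map (@ind R) (x :: s)).
Proof.
elim: s x => [|y s IH] x sN; first by exists (ind x) => //; exact: stratum_ind.
have [|q qs qt] := IH y; first by apply: leq_trans sN; rewrite /= doubleS ltnW.
pose k := (size s).*2.
pose u := @sep R k [set z | z = ind x \/ z = ind x].
pose v := @sep R k [set z | z = ind x \/ z = q].
move: sN; rewrite /= doubleS -/k => sN.
exists (sep k.+1 [set z | z = u \/ z = v]); first exact: stratum_sep.
exists q; split=> //.
  by apply/smem_sstratum/(stratum_le _ qs); rewrite -/k; lia.
exists u, v; split.
- by apply/smem_sstratum/(stratum_le _ (stratum_sep _ _)); lia.
- by apply/smem_sstratum/(stratum_le _ (stratum_sep _ _)); lia.
- by apply: is_upair_sep; [lia|exact: stratum_ind|exact: stratum_ind].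
- by apply: is_upair_sep; [lia|exact: stratum_ind|].
- by apply: is_upair_sep; [lia|exact: stratum_sep|exact: stratum_sep].
Qed.

Lemma graphP (P : set (seq R)) x s :
  (exists2 p, smem p (graph (size (x :: s)) P) &
    is_tuple mem (sstratum R (size (x :: s)).*2) p (map (@ind R) (x :: s))) <->
  P (x :: s).
Proof.
split=> [[p /smem_sep[pn [s' [s's Ps' ps']]] ps]|Pxs].
  by rewrite (is_tuple_inj (esym s's) ps ps').
have [|p ps pt] := @is_tuple_exists (size (x :: s)).*2 x s.
  by rewrite leq_double.
exists p => //; apply/smem_sep; split; last by exists (x :: s).
by apply: stratum_le ps; rewrite leq_double.
Qed.

End Tuples.

Definition bnd R n : entity (sstratum R n) := @entity_sep R n _.
Arguments bnd : clear implicits.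

Section Atoms.
Context {R : Type}.
Local Notation S := (superstructure R).
Implicit Types V W : Type.

Definition ren V W (h : V -> W) (t : term S V) : term S W :=
  match t with Var v => Var _ (h v) | Cst c => Cst _ c end.

Definition upairF n V (u x y : term S V) : formula R V :=
  let v := Var S None in
  let vxy := Or (Eq v (ren some x)) (Eq v (ren some y)) in
  All (bnd R n) (And (Imp (In v (ren some u)) vxy) (Imp vxy (In v (ren some u)))).

Definition pairF n V (p x y : term S V) : formula R V :=
  let s t := ren some (ren some t) in
  let u := Var S (Some None) in let v := Var S None in
  Ex (bnd R n) (Ex (bnd R n) (And (upairF n u (s x) (s x))
    (And (upairF n v (s x) (s y)) (upairF n (s p) u v)))).

(** The components stay in their original context [V] and the renaming [h] accumulates the
    quantifiers crossed so far. Renaming the list itself would make the recursion no longer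
    structural in [s]. *)
Fixpoint tupleF n (V : Type) (s : seq (term S V)) (W : Type) (h : V -> W)
    (p : term S W) :
    formula R W :=
  match s with
  | [::] => Not (Eq p p)
  | x :: s' => match s' with
    | [::] => Eq p (ren h x)
    | _ => Ex (bnd R n) (And (tupleF n s' (some \o h) (Var S None))
             (pairF n (ren some p) (ren (some \o h) x) (Var S None)))
    end
  end.

Definition relF V (P : set (seq R)) (s : seq (term S V)) : formula R V :=
  Ex (@entity_sep R (size s).*2 _ : entity (graph (size s) P))
     (tupleF (size s).*2 s some (Var S None)).

Section Sat.
Context {A : Type} (mem : A -> A -> Prop) (int : S -> A).
Local Notation sat := (@sat R A mem int _).

Lemma eval_ren V W (h : V -> W) (e : W -> A) (t : term S V) :
  eval int e (ren h t) = eval int (e \o h) t.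
Proof. by case: t. Qed.

Lemma sat_upairF n V (e : V -> A) u x y : sat e (upairF n u x y) <->
  is_upair mem (int (sstratum R n)) (eval int e u) (eval int e x) (eval int e y).
Proof.
rewrite /upairF /=.
by split=> H v vn; have := H v vn; rewrite !eval_ren /= => -[? ?]; split.
Qed.

Lemma sat_pairF n V (e : V -> A) p x y : sat e (pairF n p x y) <->
  is_pair mem (int (sstratum R n)) (eval int e p) (eval int e x) (eval int e y).
Proof.
split.
  move=> [u uN [v vN [/sat_upairF H1 [/sat_upairF H2 /sat_upairF H3]]]].
  by exists u, v; move: H1 H2 H3; rewrite !eval_ren.
move=> [u [v [uN vN H1 H2 H3]]]; exists u => //; exists v => //.
split; last split; apply/sat_upairF; by rewrite !eval_ren.
Qed.

Lemma sat_tupleF n V (s : seq (term S V)) W (h : V -> W) (e : W -> A) p :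
  sat e (tupleF n s h p) <-> is_tuple mem (int (sstratum R n)) (eval int e p)
    (map (eval int (e \o h)) s).
Proof.
elim: s W h e p => [|x [|y s] IH] W h e p; first by split=> //; exact.
  by rewrite /= eval_ren.
rewrite [tupleF _ _ _ _]/=; split.
  move=> [q qN [H /sat_pairF]]; rewrite !eval_ren => Hp.
  by exists q; split=> //; exact: (proj1 (IH _ (some \o h) (oapp e q) (Var S None)) H).
move=> [q [qN H Hp]]; exists q => //; split.
  exact: (proj2 (IH _ (some \o h) (oapp e q) (Var S None)) H).
by apply/sat_pairF; rewrite !eval_ren.
Qed.

Lemma sat_relF V P (s : seq (term S V)) (e : V -> A) :
  sat e (relF P s) <-> exists2 p, mem p (int (graph (size s) P)) &
    is_tuple mem (int (sstratum R (size s).*2)) p (map (eval int e) s).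
Proof.
split=> -[p pP H]; exists p => //.
  exact: (proj1 (sat_tupleF _ s some (oapp e p) (Var S None)) H).
exact: (proj2 (sat_tupleF _ s some (oapp e p) (Var S None)) H).
Qed.

End Sat.
End Atoms.

(** Transferring this formula shows that the extension of the graph of a function is again the graph
    of a total function. *)
Definition uniqF (R V : Type) P (s : seq (term (superstructure R) V)) :
    formula R V :=
  Ex (bnd R 0) (And (relF P (rcons (map (ren some) s) (Var _ None)))
    (All (bnd R 0) (Imp
      (relF P (rcons (map (ren (some \o some)) s) (Var _ None)))
      (Eq (Var _ None) (Var _ (Some None)))))).

(* The quantifiers of an [rformula] range over the reals only, and its symbols
   are arbitrary real functions and relations. *)
Inductive rterm (R V : Type) :=
  | RVar of V
  | RCst of R
  | RFun1 of (R -> R) & rterm R V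
  | RFun2 of (R -> R -> R) & rterm R V & rterm R V
  | RFun4 of (R -> R -> R -> R -> R) &
      rterm R V & rterm R V & rterm R V & rterm R V.

Inductive rformula (R V : Type) :=
  | REq of rterm R V & rterm R V
  | RRel1 (I : Type) of (I -> R) & rterm R V
  | RRel2 of (R -> R -> Prop) & rterm R V & rterm R V
  | RNot of rformula R V
  | RAnd of rformula R V & rformula R V
  | ROr of rformula R V & rformula R V
  | RImp of rformula R V & rformula R V
  | RAll of rformula R (option V)
  | REx of rformula R (option V).

Definition rel1 (R I : Type) (h : I -> R) : set (seq R) :=
  [set s | exists k, s = [:: h k]].
Definition rel2 (R : Type) (Q : R -> R -> Prop) : set (seq R) :=
  [set s | exists a b, s = [:: a; b] /\ Q a b].
Definition fun1 (R : Type) (f : R -> R) : set (seq R) :=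
  [set s | exists a, s = [:: a; f a]].
Definition fun2 (R : Type) (f : R -> R -> R) : set (seq R) :=
  [set s | exists a b, s = [:: a; b; f a b]].
Definition fun4 (R : Type) (f : R -> R -> R -> R -> R) : set (seq R) :=
  [set s | exists a b c d, s = [:: a; b; c; d; f a b c d]].

(** The semantics is abstracted over the domain, so that one correctness proof of the translation
    serves both the reals and the hyperreals. *)
Record interp (R D : Type) := Interp {
  icst : R -> D;
  ifun1 : (R -> R) -> D -> D;
  ifun2 : (R -> R -> R) -> D -> D -> D;
  ifun4 : (R -> R -> R -> R -> R) -> D -> D -> D -> D -> D;
  irel1 : forall I : Type, (I -> R) -> D -> Prop;
  irel2 : (R -> R -> Prop) -> D -> D -> Prop }.

Fixpoint reval (R D : Type) (J : interp R D) (V : Type) (e : V -> D)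
    (t : rterm R V) : D :=
  match t with
  | RVar v => e v
  | RCst r => icst J r
  | RFun1 f t => ifun1 J f (reval J e t)
  | RFun2 f t u => ifun2 J f (reval J e t) (reval J e u)
  | RFun4 f t u v w =>
      ifun4 J f (reval J e t) (reval J e u) (reval J e v) (reval J e w)
  end.

Fixpoint rsat (R D : Type) (J : interp R D) (V : Type) (e : V -> D)
    (phi : rformula R V) : Prop :=
  match phi with
  | REq t u => reval J e t = reval J e u
  | RRel1 T h t => irel1 J h (reval J e t)
  | RRel2 Q t u => irel2 J Q (reval J e t) (reval J e u)
  | RNot p => ~ rsat J e p
  | RAnd p q => rsat J e p /\ rsat J e q
  | ROr p q => rsat J e p \/ rsat J e q
  | RImp p q => rsat J e p -> rsat J e q
  | RAll p => forall a, rsat J (oapp e a) p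
  | REx p => exists a, rsat J (oapp e a) p
  end.

Section Translation.
Context {R : Type}.
Local Notation S := (superstructure R).

(* [trt t h k] says that the context [k] holds of the value of [t]; a context is
   instantiated under the quantifiers introduced for the values of subterms. *)
Fixpoint trt (V : Type) (t : rterm R V) (W : Type) (h : V -> W)
    (k : forall W' : Type, (W -> W') -> term S W' -> formula R W') : formula R W :=
  match t with
  | RVar v => k W id (Var S (h v))
  | RCst r => k W id (Cst _ (ind r))
  | RFun1 f t => trt t h (fun W1 h1 x =>
      Ex (bnd R 0) (And (relF (fun1 f) [:: ren some x; Var S None])
                      (k _ (some \o h1) (Var S None))))
  | RFun2 f t u => trt t h (fun W1 h1 x => trt u (h1 \o h) (fun W2 h2 y =>
      Ex (bnd R 0) (And (relF (fun2 f)
          [:: ren (some \o h2) x; ren some y; Var S None])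
        (k _ (some \o h2 \o h1) (Var S None)))))
  | RFun4 f t u v w =>
      trt t h (fun W1 h1 x => trt u (h1 \o h) (fun W2 h2 y =>
      trt v (h2 \o h1 \o h) (fun W3 h3 z =>
      trt w (h3 \o h2 \o h1 \o h) (fun W4 h4 r =>
      Ex (bnd R 0) (And (relF (fun4 f)
          [:: ren (some \o h4 \o h3 \o h2) x; ren (some \o h4 \o h3) y;
              ren (some \o h4) z; ren some r; Var S None])
        (k _ (some \o h4 \o h3 \o h2 \o h1) (Var S None)))))))
  end.

Fixpoint trf (V : Type) (phi : rformula R V) : formula R V :=
  match phi with
  | REq t u => trt t id (fun W1 h1 x => trt u h1 (fun W2 h2 y =>
      Eq (ren h2 x) y))
  | RRel1 T h t => trt t id (fun W1 h1 x => relF (rel1 h) [:: x])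
  | RRel2 Q t u => trt t id (fun W1 h1 x => trt u h1 (fun W2 h2 y =>
      relF (rel2 Q) [:: ren h2 x; y]))
  | RNot p => Not (trf p)
  | RAnd p q => And (trf p) (trf q)
  | ROr p q => Or (trf p) (trf q)
  | RImp p q => Imp (trf p) (trf q)
  | RAll p => All (bnd R 0) (trf p)
  | REx p => Ex (bnd R 0) (trf p)
  end.

Section Correct.
Implicit Types V W : Type.
Context {A D : Type} (mem : A -> A -> Prop) (int : S -> A) (hv : D -> A)
  (J : interp R D).
Let rel P (s : seq D) := exists2 p, mem p (int (graph (size s) P)) &
  is_tuple mem (int (sstratum R (size s).*2)) p (map hv s).
Hypothesis hv_inj : injective hv.
Hypothesis hvP : forall a, mem a (int (sstratum R 0)) <-> exists x, a = hv x.
Hypothesis cstE : forall r, hv (icst J r) = int (ind r).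
Hypothesis fun1E : forall f x y, rel (fun1 f) [:: x; y] <-> y = ifun1 J f x.
Hypothesis fun2E : forall f x y z,
  rel (fun2 f) [:: x; y; z] <-> z = ifun2 J f x y.
Hypothesis fun4E : forall f x y z t u,
  rel (fun4 f) [:: x; y; z; t; u] <-> u = ifun4 J f x y z t.
Hypothesis rel1E : forall I (h : I -> R) x, rel (rel1 h) [:: x] <-> irel1 J h x.
Hypothesis rel2E : forall Q x y, rel (rel2 Q) [:: x; y] <-> irel2 J Q x y.

Lemma sat_Ex_bnd V (e : V -> A) p : sat mem int e (Ex (bnd R 0) p) <->
  exists x, sat mem int (oapp e (hv x)) p.
Proof.
split=> [[a /hvP[x ->] H]|[x H]]; first by exists x.
by exists (hv x) => //; apply/hvP; exists x.
Qed.

Lemma sat_All_bnd V (e : V -> A) p : sat mem int e (All (bnd R 0) p) <->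
  forall x, sat mem int (oapp e (hv x)) p.
Proof.
split=> [H x|H a /hvP[x ->]]; last exact: H.
by apply: H; apply/hvP; exists x.
Qed.

Lemma sat_relF_hv V P (s : seq (term S V)) (e : V -> A) (xs : seq D) :
  map (eval int e) s = map hv xs -> sat mem int e (relF P s) <-> rel P xs.
Proof.
by move=> sxs; rewrite sat_relF sxs -(size_map (eval int e) s) sxs size_map.
Qed.

Lemma sat_uniqF V P (s : seq (term S V)) (e : V -> A) (xs : seq D) :
  map (eval int e) s = map hv xs -> sat mem int e (uniqF P s) <->
  exists x, rel P (rcons xs x) /\ forall y, rel P (rcons xs y) -> y = x.
Proof.
move=> sxs.
have s1 x : map (eval int (oapp e (hv x))) (rcons (map (ren some) s) (Var _ None))
    = map hv (rcons xs x).
  rewrite !map_rcons -sxs -map_comp; congr (rcons _ _).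
  by apply: eq_map => t /=; rewrite eval_ren.
have s2 x y : map (eval int (oapp (oapp e (hv x)) (hv y)))
    (rcons (map (ren (some \o some)) s) (Var _ None)) = map hv (rcons xs y).
  rewrite !map_rcons -sxs -map_comp; congr (rcons _ _).
  by apply: eq_map => t /=; rewrite eval_ren.
rewrite sat_Ex_bnd; split=> -[x [H1 H2]]; exists x; split.
- exact: (proj1 (sat_relF_hv _ (s1 x)) H1).
- move=> y Hy; apply/hv_inj/(H2 (hv y)); first by apply/hvP; exists y.
  exact: (proj2 (sat_relF_hv _ (s2 x y)) Hy).
- exact: (proj2 (sat_relF_hv _ (s1 x)) H1).
- move=> _ /hvP[y ->] Hy; congr hv; apply: H2.
  exact: (proj1 (sat_relF_hv _ (s2 x y)) Hy).
Qed.

Lemma sat_Ex_relF V (e : V -> A) P s q :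
  sat mem int e (Ex (bnd R 0) (And (relF P s) q)) <->
  exists x, (exists2 p, mem p (int (graph (size s) P)) &
    is_tuple mem (int (sstratum R (size s).*2)) p
      (map (eval int (oapp e (hv x))) s)) /\ sat mem int (oapp e (hv x)) q.
Proof.
rewrite sat_Ex_bnd; split=> -[x [H1 H2]]; exists x; split=> //.
  exact: (proj1 (sat_relF _ _ _ _ _) H1).
exact: (proj2 (sat_relF _ _ _ _ _) H1).
Qed.

(** The context [k] must have the same truth value [Phi] in every environment that extends [e],
    since it is instantiated below the quantifiers that name the values of subterms. Those
    quantifiers are harmless: by functionality, the value of a subterm is the only possible
    witness. *)
Lemma sat_trt V (t : rterm R V) W (h : V -> W) k (e : W -> A) (e' : V -> D) Phi :
  e \o h = hv \o e' ->
  (forall W' (s : W -> W') y e'', e'' \o s = e ->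
     eval int e'' y = hv (reval J e' t) -> (sat mem int e'' (k W' s y) <-> Phi)) ->
  sat mem int e (trt t h k) <-> Phi.
Proof.
elim: t W h k e Phi => [v|r|f t IH|f t IHt u IHu|f t IHt u IHu v IHv w IHw]
    W h k e Phi eh H /=.
- by apply: H => //; exact: (congr1 (fun g => g v) eh).
- by apply: H => //=; rewrite cstE.
- apply: IH => // W' s y e'' es ey; rewrite sat_Ex_relF; split.
    move=> [x []]; rewrite /= eval_ren [eval _ _ y]ey => /(fun1E f _ x) ->.
    by move/H; apply.
  move=> phi; exists (ifun1 J f (reval J e' t)); split; last by apply/H.
  by rewrite /= eval_ren [eval _ _ y]ey; apply/(fun1E f).
- apply: IHt => // W1 h1 x e1 eh1 ex.
  apply: IHu; first by rewrite -eh -eh1.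
  move=> W2 h2 y e2 eh2 ey; rewrite sat_Ex_relF.
  have ex2 : eval int (e2 \o h2) x = hv (reval J e' t) by rewrite eh2.
  split.
    move=> [z []]; rewrite /= !eval_ren [eval _ _ x]ex2 [eval _ _ y]ey.
    move=> /(fun2E f _ _ z) ->.
    by move/H; apply => //; rewrite -eh1 -eh2.
  move=> phi; exists (ifun2 J f (reval J e' t) (reval J e' u)); split.
    rewrite /= !eval_ren [eval _ _ x]ex2 [eval _ _ y]ey.
    exact/(fun2E f).
  by apply/H => //; rewrite -eh1 -eh2.
- apply: IHt => // W1 h1 x e1 eh1 ex.
  apply: IHu; first by rewrite -eh -eh1.
  move=> W2 h2 y e2 eh2 ey.
  apply: IHv; first by rewrite -eh -eh1 -eh2.
  move=> W3 h3 z e3 eh3 ez.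
  apply: IHw; first by rewrite -eh -eh1 -eh2 -eh3.
  move=> W4 h4 r e4 eh4 er; rewrite sat_Ex_relF.
  have ex2 : eval int (e4 \o h4 \o h3 \o h2) x = hv (reval J e' t).
    by rewrite eh4 eh3 eh2.
  have ey2 : eval int (e4 \o h4 \o h3) y = hv (reval J e' u) by rewrite eh4 eh3.
  have ez2 : eval int (e4 \o h4) z = hv (reval J e' v) by rewrite eh4.
  split.
    move=> [q []]; rewrite /= !eval_ren.
    rewrite [eval _ _ x]ex2 [eval _ _ y]ey2 [eval _ _ z]ez2 [eval _ _ r]er.
    move=> /(fun4E f _ _ _ _ q) ->.
    by move/H; apply => //; rewrite -eh1 -eh2 -eh3 -eh4.
  move=> phi; eexists; split; last by apply/H; first by rewrite -eh1 -eh2 -eh3 -eh4.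
  rewrite /= !eval_ren.
  rewrite [eval _ _ x]ex2 [eval _ _ y]ey2 [eval _ _ z]ez2 [eval _ _ r]er.
  exact/(fun4E f).
Qed.

Lemma sat_trf V (phi : rformula R V) (e : V -> A) (e' : V -> D) :
  e = hv \o e' -> sat mem int e (trf phi) <-> rsat J e' phi.
Proof.
elim: phi e e' => {V} V.
- move=> t u e e' ee /=; apply: (sat_trt (e' := e')) => [//|W1 h1 x e1 eh1 ex].
  apply: (sat_trt (e' := e')); first by rewrite eh1.
  move=> W2 h2 y e2 eh2 ey /=; rewrite eval_ren eh2 ex ey.
  by split=> [/hv_inj|->].
- move=> I h t e e' ee /=; apply: (sat_trt (e' := e')) => [//|W1 h1 x e1 eh1 ex].
  by rewrite sat_relF /= ex; exact: (rel1E h).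
- move=> Q t u e e' ee /=; apply: (sat_trt (e' := e')) => [//|W1 h1 x e1 eh1 ex].
  apply: (sat_trt (e' := e')); first by rewrite eh1.
  move=> W2 h2 y e2 eh2 ey; rewrite sat_relF /= eval_ren eh2 ex ey.
  exact: (rel2E Q).
- by move=> p IH e e' /IH /= ->.
- by move=> p IHp q IHq e e' ee /=; rewrite (IHp _ _ ee) (IHq _ _ ee).
- by move=> p IHp q IHq e e' ee /=; rewrite (IHp _ _ ee) (IHq _ _ ee).
- by move=> p IHp q IHq e e' ee /=; rewrite (IHp _ _ ee) (IHq _ _ ee).
- move=> p IH e e' ee.
  have oe a : oapp e (hv a) = hv \o oapp e' a by rewrite ee; apply/funext; case.
  split=> [H a|H a /hvP[x ->]]; last exact: (proj2 (IH _ _ (oe x)) (H x)).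
  by apply: (proj1 (IH _ _ (oe a)) (H (hv a) _)); apply/hvP; exists a.
- move=> p IH e e' ee.
  have oe a : oapp e (hv a) = hv \o oapp e' a by rewrite ee; apply/funext; case.
  rewrite [trf _]/= sat_Ex_bnd; split=> -[x H]; exists x.
    exact: (proj1 (IH _ _ (oe x)) H).
  exact: (proj2 (IH _ _ (oe x)) H).
Qed.

End Correct.
End Translation.

Definition std_interp (R : Type) : interp R R :=
  Interp id id id id (fun _ h x => exists k, x = h k) id.

Definition nstd_interp (R : Type) (M : nonstandard_model R) :
    interp R (hyperreal M) :=
  Interp (hstd M) (@hfun1 R M) (@hfun2 R M) (@hfun4 R M)
    (fun _ h x => hrel (rel1 h) [:: x])
    (fun Q x y => hrel (rel2 Q) [:: x; y]).

Section Transfer.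
Context {R : Type} (M : nonstandard_model R).
Local Notation mem := (@smem R).

Lemma smem_R (X : superstructure R) :
  smem X (sstratum R 0) <-> exists r, X = ind r.
Proof.
by rewrite smem_sstratum; split=> [[r _ <-]|[r ->]]; exists r.
Qed.

Lemma hval_inj : injective (@hval R M).
Proof.
move=> [x xP] [y yP] /= xy; case: _ / xy in yP *.
by congr Hyperreal; exact: Prop_irrelevance.
Qed.

Lemma nmem_R (a : carrier M) :
  nmem a (star M (sstratum R 0)) <-> exists x : hyperreal M, a = hval x.
Proof.
split=> [aR|[x ->]]; last exact: hvalP.
by exists (Hyperreal aR).
Qed.

Lemma rel_std (P : set (seq R)) s : (0 < size s)%N ->
  (exists2 p, smem p (graph (size s) P) &
    is_tuple mem (sstratum R (size s).*2) p (map (@ind R) s)) <-> P s.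
Proof. by case: s => // x s _; exact: graphP. Qed.

Let sat_uniqF_std V P (s : seq (term _ V)) (e : V -> _) (xs : seq R) :
  map (eval id e) s = map (@ind R) xs ->
  (exists y, P (rcons xs y) /\ forall z, P (rcons xs z) -> z = y) ->
  sat mem id e (uniqF P s).
Proof.
move=> sxs [y [Py Pz]].
apply/(proj2 (sat_uniqF (@ind_inj R) smem_R _ sxs)); exists y; split.
  by apply/rel_std => //; rewrite size_rcons.
by move=> z /rel_std; rewrite size_rcons => /(_ isT)/Pz.
Qed.

Let sat_uniqF_nstd V P (s : seq (term _ V)) (e : V -> carrier M)
    (xs : seq (hyperreal M)) :
  sat (@nmem R M) (star M) e (uniqF P s) ->
  map (eval (star M) e) s = map (@hval R M) xs ->
  exists y, hrel P (rcons xs y) /\ forall z, hrel P (rcons xs z) -> z = y.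
Proof. by move=> H sxs; move/(sat_uniqF hval_inj nmem_R _ sxs): H. Qed.

Let sat_All_std := sat_All_bnd (int := id) (mem := mem) smem_R.
Let sat_All_nstd x V e (p : formula R (option V)) :
  sat (@nmem R M) (star M) e (All (bnd R 0) p) ->
  sat (@nmem R M) (star M) (oapp e (hval x)) p.
Proof. by move/(proj1 (sat_All_bnd nmem_R e p)). Qed.

Let S := superstructure R.

(** Existence and uniqueness of the value are transferred together; hence the default value of
    [xget] in [hfun1] never occurs. *)
Lemma hfun1P (f : R -> R) (x y : hyperreal M) :
  hrel (fun1 f) [:: x; y] <-> y = hfun1 f x.
Proof.
have : holds mem id (All (bnd R 0) (uniqF (fun1 f) [:: Var S None])).
  apply/sat_All_std => a; apply: (@sat_uniqF_std _ _ _ _ [:: a]) => //.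
  by exists (f a); split=> [|b [a' [-> ->]]]; first by exists a.
move=> /(transfer M); rewrite /holds => H.
have := sat_uniqF_nstd (sat_All_nstd x H) (xs := [:: x]).
case=> // z [xz uz].
have xy : hrel (fun1 f) [:: x; hfun1 f x].
  exact: (@xgetI _ x [set y | hrel (fun1 f) [:: x; y]] z xz).
by split=> [/uz ->|->//]; rewrite (uz _ xy).
Qed.

Lemma hfun2P (f : R -> R -> R) (x y z : hyperreal M) :
  hrel (fun2 f) [:: x; y; z] <-> z = hfun2 f x y.
Proof.
have : holds mem id (All (bnd R 0) (All (bnd R 0)
    (uniqF (fun2 f) [:: Var S (Some None); Var S None]))).
  apply/sat_All_std => a; apply/sat_All_std => b.
  apply: (@sat_uniqF_std _ _ _ _ [:: a; b]) => //.
  by exists (f a b); split=> [|c [a' [b' [-> -> ->]]]]; first by exists a, b.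
move=> /(transfer M); rewrite /holds => H.
have := sat_uniqF_nstd (sat_All_nstd y (sat_All_nstd x H)) (xs := [:: x; y]).
case=> // u [xu uu].
have xy : hrel (fun2 f) [:: x; y; hfun2 f x y].
  exact: (@xgetI _ x [set z | hrel (fun2 f) [:: x; y; z]] u xu).
by split=> [/uu ->|->//]; rewrite (uu _ xy).
Qed.

Lemma hfun4P (f : R -> R -> R -> R -> R) (x y z t u : hyperreal M) :
  hrel (fun4 f) [:: x; y; z; t; u] <-> u = hfun4 f x y z t.
Proof.
have : holds mem id (All (bnd R 0) (All (bnd R 0) (All (bnd R 0) (All (bnd R 0)
    (uniqF (fun4 f) [:: Var S (Some (Some (Some None)));
      Var S (Some (Some None)); Var S (Some None); Var S None]))))).
  apply/sat_All_std => a; apply/sat_All_std => b.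
  apply/sat_All_std => c; apply/sat_All_std => d.
  apply: (@sat_uniqF_std _ _ _ _ [:: a; b; c; d]) => //.
  exists (f a b c d); split=> [|r [a' [b' [c' [d' [-> -> -> -> ->]]]]]] //.
  by exists a, b, c, d.
move=> /(transfer M); rewrite /holds => H.
have {}H := sat_All_nstd t (sat_All_nstd z (sat_All_nstd y (sat_All_nstd x H))).
have := sat_uniqF_nstd H (xs := [:: x; y; z; t]).
case=> // v [xv uv].
have xy : hrel (fun4 f) [:: x; y; z; t; hfun4 f x y z t].
  exact: (@xgetI _ x [set u | hrel (fun4 f) [:: x; y; z; t; u]] v xv).
by split=> [/uv ->|->//]; rewrite (uv _ xy).
Qed.

Lemma sat_trf_std V (phi : rformula R V) (e : V -> R) :
  sat mem id (@ind R \o e) (trf phi) <-> rsat (std_interp R) e phi.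
Proof.
apply: (sat_trf (J := std_interp R) (@ind_inj R) smem_R) => //.
- by move=> f x y; rewrite rel_std //; split=> [[a [-> ->]]|->]; last exists x.
- move=> f x y z; rewrite rel_std //.
  by split=> [[a [b [-> -> ->]]]|->]; last exists x, y.
- move=> f x y z t u; rewrite rel_std //.
  by split=> [[a [b [c [d [-> -> -> -> ->]]]]]|->]; last exists x, y, z, t.
- by move=> T h x; rewrite rel_std //; split=> [[k [->]]|[k ->]]; exists k.
- move=> Q x y; rewrite rel_std //.
  by split=> [[a [b [[-> ->]]]]|]; last exists x, y.
Qed.

Lemma sat_trf_nstd V (phi : rformula R V) (e : V -> hyperreal M) :
  sat (@nmem R M) (star M) (@hval R M \o e) (trf phi) <->
  rsat (nstd_interp M) e phi.
Proof.
apply: (sat_trf (J := nstd_interp M) hval_inj nmem_R) => //.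
- exact: hfun1P.
- exact: hfun2P.
- exact: hfun4P.
Qed.

Lemma rtransfer (phi : rformula R void) :
  rsat (std_interp R) (of_void _) phi -> rsat (nstd_interp M) (of_void _) phi.
Proof.
move=> /sat_trf_std H; apply/sat_trf_nstd.
have -> : @hval R M \o of_void _ = of_void _ by apply/funext; case.
apply/(transfer M); rewrite /holds.
by have <- : @ind R \o of_void _ = of_void _ by apply/funext; case.
Qed.

End Transfer.

(** * The ordered field of hyperreals *)

Arguments RVar {R V} _.
Arguments RCst {R V} _.
Local Notation v0 := (RVar None).
Local Notation v1 := (RVar (Some None)).
Local Notation v2 := (RVar (Some (Some None))).
Local Notation v3 := (RVar (Some (Some (Some None)))).
Local Notation v4 := (RVar (Some (Some (Some (Some None))))).
Local Notation v5 := (RVar (Some (Some (Some (Some (Some None)))))).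
Local Notation Add := (RFun2 (fun a b => a + b)).
Local Notation Sub := (RFun2 (fun a b => a - b)).
Local Notation Mul := (RFun2 (fun a b => a * b)).
Local Notation Div := (RFun2 (fun a b => a / b)).
Local Notation Opp := (RFun1 (fun a => - a)).
Local Notation Abs := (RFun1 (fun a => `|a|)).
Local Notation Exp := (RFun1 (fun a => expR a)).
Local Notation Log := (RFun1 (fun a => ln a)).
Local Notation Lt := (RRel2 (fun a b => (a < b)%R)).
Local Notation Le := (RRel2 (fun a b => (a <= b)%R)).

Section Field.
Context {R : realType} {M : nonstandard_model R}.
Local Notation hR := (hyperreal M).
Implicit Types x y z : hR.
Local Notation transfer phi := (@rtransfer R M phi).

Lemma haddA : associative (@hadd R M).
Proof.
move=> x y z; exact: (transfer (RAll (RAll (RAll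
  (REq (Add v2 (Add v1 v0)) (Add (Add v2 v1) v0))))) (@addrA R) x y z).
Qed.

Lemma haddC : commutative (@hadd R M).
Proof.
by move=> x y; exact: (transfer (RAll (RAll (REq (Add v1 v0) (Add v0 v1))))
  (@addrC R) x y).
Qed.

Lemma hadd0 : left_id hzero (@hadd R M).
Proof. exact: (transfer (RAll (REq (Add (RCst 0) v0) v0)) (@add0r R)). Qed.

Lemma haddN : left_inverse hzero (@hopp R M) hadd.
Proof. exact: (transfer (RAll (REq (Add (Opp v0) v0) (RCst 0))) (@addNr R)). Qed.

HB.instance Definition _ := GRing.isZmodule.Build hR haddA haddC hadd0 haddN.

Lemma hmulA : associative (@hmul R M).
Proof.
exact: (transfer (RAll (RAll (RAll
  (REq (Mul v2 (Mul v1 v0)) (Mul (Mul v2 v1) v0))))) (@mulrA R)).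
Qed.

Lemma hmulC : commutative (@hmul R M).
Proof.
exact: (transfer (RAll (RAll (REq (Mul v1 v0) (Mul v0 v1)))) (@mulrC R)).
Qed.

Lemma hmul1 : left_id hone (@hmul R M).
Proof. exact: (transfer (RAll (REq (Mul (RCst 1) v0) v0)) (@mul1r R)). Qed.

Lemma hmulDl : left_distributive (@hmul R M) hadd.
Proof.
exact: (transfer (RAll (RAll (RAll
  (REq (Mul (Add v2 v1) v0) (Add (Mul v2 v0) (Mul v1 v0)))))) (@mulrDl R)).
Qed.

Lemma hone_neq0 : hone != 0 :> hR.
Proof.
by apply/eqP; apply: (transfer (RNot (REq (RCst 1) (RCst 0)))); exact/eqP/oner_neq0.
Qed.

HB.instance Definition _ :=
  GRing.Zmodule_isComNzRing.Build hR hmulA hmulC hmul1 hmulDl hone_neq0.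

Lemma hmulV x : x != 0 -> hdiv hone x * x = 1.
Proof.
move/eqP; apply: (transfer (RAll (RImp (RNot (REq v0 (RCst 0)))
  (REq (Mul (Div (RCst 1) v0) v0) (RCst 1))))) => a /eqP a0 /=.
by rewrite mul1r mulVf.
Qed.

Lemma hinv0 : hdiv hone 0 = 0 :> hR.
Proof.
by apply: (transfer (REq (Div (RCst 1) (RCst 0)) (RCst 0))); rewrite /= invr0 mulr0.
Qed.

HB.instance Definition _ := GRing.ComNzRing_isField.Build hR hmulV hinv0.

Lemma hle_add x y : `[< hle 0 x >] -> `[< hle 0 y >] -> `[< hle 0 (x + y) >].
Proof.
move=> /asboolP + /asboolP + ; move=> h k; apply/asboolP; move: x y h k.
exact: (transfer (RAll (RAll (RImp (Le (RCst 0) v1) (RImp (Le (RCst 0) v0)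
  (Le (RCst 0) (Add v1 v0)))))) (@addr_ge0 R)).
Qed.

Lemma hle_mul x y : `[< hle 0 x >] -> `[< hle 0 y >] -> `[< hle 0 (x * y) >].
Proof.
move=> /asboolP + /asboolP + ; move=> h k; apply/asboolP; move: x y h k.
exact: (transfer (RAll (RAll (RImp (Le (RCst 0) v1) (RImp (Le (RCst 0) v0)
  (Le (RCst 0) (Mul v1 v0)))))) (@mulr_ge0 R)).
Qed.

Lemma hle_anti x : `[< hle 0 x >] -> `[< hle x 0 >] -> x = 0.
Proof.
move=> /asboolP + /asboolP; apply: (transfer (RAll (RImp (Le (RCst 0) v0)
  (RImp (Le v0 (RCst 0)) (REq v0 (RCst 0)))))) => a /= h k.
by apply/eqP; rewrite eq_le h k.
Qed.

Lemma hle_sub x y : `[< hle 0 (y - x) >] = `[< hle x y >].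
Proof.
apply: asbool_equiv_eq; split; move: x y.
  apply: (transfer (RAll (RAll (RImp
    (Le (RCst 0) (Add v0 (Opp v1))) (Le v1 v0))))) => a b /=.
  by rewrite subr_ge0.
apply: (transfer (RAll (RAll (RImp (Le v1 v0)
  (Le (RCst 0) (Add v0 (Opp v1))))))) => a b /=.
by rewrite subr_ge0.
Qed.

Lemma hle_total x : `[< hle 0 x >] || `[< hle x 0 >].
Proof.
apply/orP.
suff [h|h] : hle 0 x \/ hle x 0 by [left; apply/asboolP|right; apply/asboolP].
apply: (transfer (RAll (ROr (Le (RCst 0) v0) (Le v0 (RCst 0))))) => a /=.
by apply/orP; exact: le_total.
Qed.

Lemma habsN x : habs (- x) = habs x.
Proof. exact: (transfer (RAll (REq (Abs (Opp v0)) (Abs v0))) (@normrN R R)). Qed.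

Lemma habs_ge0 x : `[< hle 0 x >] -> habs x = x.
Proof.
move/asboolP; apply: (transfer (RAll (RImp (Le (RCst 0) v0) (REq (Abs v0) v0)))).
by move=> a /ger0_norm.
Qed.

Lemma hlt_def x y : `[< hlt x y >] = (y != x) && `[< hle x y >].
Proof.
apply/asboolP/andP.
  move=> xy; suff [/eqP ? ?] : ~ y = x /\ hle x y by split=> //; exact/asboolP.
  move: xy; apply: (transfer (RAll (RAll (RImp (Lt v1 v0)
    (RAnd (RNot (REq v0 v1)) (Le v1 v0)))))) => a b /=.
  by rewrite lt_def => /andP[/eqP].
move=> [/eqP + /asboolP]; apply: (transfer (RAll (RAll (RImp (RNot (REq v0 v1))
  (RImp (Le v1 v0) (Lt v1 v0)))))) => a b /= /eqP ba ab.
by rewrite lt_def ba.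
Qed.

HB.instance Definition _ := Num.IntegralDomain_isLeReal.Build hR
  hle_add hle_mul hle_anti hle_sub hle_total habsN habs_ge0 hlt_def.

Lemma hleE x y : hle x y <-> x <= y.
Proof. by split=> [?|/asboolP]; first exact/asboolP. Qed.

Lemma hltE x y : hlt x y <-> x < y.
Proof. by split=> [?|/asboolP]; first exact/asboolP. Qed.

Lemma hsubE x y : hsub x y = x - y.
Proof.
exact: (transfer (RAll (RAll (REq (Sub v1 v0) (Add v1 (Opp v0))))) (fun a b => erefl)).
Qed.

Lemma hdivE x y : hdiv x y = x / y.
Proof.
apply: (transfer (RAll (RAll (REq (Div v1 v0) (Mul v1 (Div (RCst 1) v0)))))).
by move=> a b /=; rewrite mul1r.
Qed.

Local Notation std := (hstd M).

Lemma hstdD (a b : R) : std (a + b) = std a + std b.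
Proof. exact: (transfer (REq (RCst (a + b)) (Add (RCst a) (RCst b))) erefl). Qed.

Lemma hstdN (a : R) : std (- a) = - std a.
Proof. exact: (transfer (REq (RCst (- a)) (Opp (RCst a))) erefl). Qed.

Lemma hstdM (a b : R) : std (a * b) = std a * std b.
Proof. exact: (transfer (REq (RCst (a * b)) (Mul (RCst a) (RCst b))) erefl). Qed.

Lemma hstd_le (a b : R) : (std a <= std b) = (a <= b).
Proof.
apply/idP/idP => [|ab].
  apply: contraTT; rewrite -!ltNge => ba; apply/hltE.
  exact: (transfer (Lt (RCst b) (RCst a)) ba).
exact/hleE/(transfer (Le (RCst a) (RCst b)) ab).
Qed.

Lemma hexpD x y : hexp (x + y) = hexp x * hexp y.
Proof.
exact: (transfer (RAll (RAll (REq (Exp (Add v1 v0)) (Mul (Exp v1) (Exp v0)))))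
  (@expRD R)).
Qed.

Lemma hexp_gt0 x : 0 < hexp x.
Proof.
by apply/hltE; apply: (transfer (RAll (Lt (RCst 0) (Exp v0)))); exact: expR_gt0.
Qed.

Lemma hexp_ge1Dx x : 1 + x <= hexp x.
Proof.
apply/hleE; apply: (transfer (RAll (Le (Add (RCst 1) v0) (Exp v0)))).
exact: expR_ge1Dx.
Qed.

Lemma hexp_std (a : R) : hexp (std a) = std (expR a).
Proof. exact: (transfer (REq (Exp (RCst a)) (RCst (expR a))) erefl). Qed.

Lemma hlogK x : 0 < x -> hexp (hlog x) = x.
Proof.
move/hltE; apply: (transfer (RAll (RImp (Lt (RCst 0) v0)
  (REq (Exp (Log v0)) v0)))) => a /= a0.
by rewrite lnK.
Qed.

Lemma hfloor_2pi x : exists k, hint k /\ 0 <= x - std (2 * pi) * k < std (2 * pi).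
Proof.
suff [k [kZ [/hleE h1 /hltE h2]]] : exists k : hR, hint k /\
    hle 0 (x - std (2 * pi) * k) /\ hlt (x - std (2 * pi) * k) (std (2 * pi)).
  by exists k; split=> //; apply/andP.
apply: (transfer (RAll (REx (RAnd (RRel1 (fun k : int => k%:~R) v0)
  (RAnd (Le (RCst 0) (Add v1 (Opp (Mul (RCst (2 * pi)) v0))))
    (Lt (Add v1 (Opp (Mul (RCst (2 * pi)) v0))) (RCst (2 * pi)))))))).
move=> a /=; exists (Num.floor (a / (2 * pi)))%:~R; split; first by eexists.
have p0 : 0 < 2 * pi :> R by rewrite mulr_gt0 ?pi_gt0.
have /andP[] := floor_itv (a / (2 * pi)).
rewrite rmorphD /= ler_pdivlMr // ltr_pdivrMr //; lra.
Qed.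

Lemma hintD1 x : hint x -> hint (x + 1).
Proof.
apply: (transfer (RAll (RImp (RRel1 (fun k : int => k%:~R) v0)
  (RRel1 (fun k : int => k%:~R) (Add v0 (RCst 1)))))) => a /= [k ->].
by exists (k + 1)%Z; rewrite rmorphD.
Qed.

Lemma hintN x : hint x -> hint (- x).
Proof.
apply: (transfer (RAll (RImp (RRel1 (fun k : int => k%:~R) v0)
  (RRel1 (fun k : int => k%:~R) (Opp v0))))) => a /= [k ->].
by exists (- k)%Z; rewrite rmorphN.
Qed.

End Field.

(* Unification would otherwise unfold arithmetic down to the model. *)
#[global] Opaque hfun1 hfun2 hfun4 hrel.

(* Conversion tests on concrete hyperreals are slow, as they unfold the instances:
   the arithmetic is done in an abstract extension of R, and the predicates below
   are inductive so as not to be unfolded. *)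
Class order_embedding (R : realType) (F : realFieldType) (std : R -> F) := {
  embD : forall a b, std (a + b) = std a + std b;
  embN : forall a, std (- a) = - std a;
  embM : forall a b, std (a * b) = std a * std b;
  emb1 : std 1 = 1;
  emb_le : forall a b, (std a <= std b) = (a <= b) }.

(** * Standard parts and orders of magnitude *)

Section StandardPart.
Context {R : realType} {F : realFieldType} {std : R -> F}.
Context {emb : order_embedding std}.
Implicit Types x y z : F.

Variant fin x : Prop := Fin (K : R) of `|x| < std K.
Variant infml x : Prop := Infml of forall e : R, 0 < e -> `|x| < std e.
(** [dom] and [negl] are the relations x = O(y) and x = o(y) with standard constants. The strict
    inequality in [negl] forces y to be nonzero, so that 0 is not negligible against 0. *)
Variant dom x y : Prop := Dom (K : R) of `|x| <= std K * `|y|.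
Variant negl x y : Prop :=
  Negl of forall e : R, 0 < e -> `|x| < std e * `|y|.
Definition stdpart x := xget 0 [set r : R | infml (x - std r)].

Lemma emb0 : std 0 = 0.
Proof. by apply: (addrI (std 0)); rewrite -embD !addr0. Qed.

Lemma emb_lt (a b : R) : (std a < std b) = (a < b).
Proof. by rewrite !ltNge emb_le. Qed.

Lemma emb_norm (a : R) : std `|a| = `|std a|.
Proof.
have [a0|a0] := leP 0 a; first by rewrite ger0_norm // ger0_norm // -emb0 emb_le.
by rewrite ltr0_norm // ltr0_norm ?embN // -emb0 emb_lt.
Qed.

Lemma embB (a b : R) : std (a - b) = std a - std b.
Proof. by rewrite embD embN. Qed.

Lemma emb_nat n : std n%:R = n%:R.
Proof.
elim: n => [|n IH]; first exact: emb0.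
by rewrite -[n.+1]addn1 !natrD embD IH emb1.
Qed.

Lemma emb_inj : injective std.
Proof. by move=> a b ab; apply/eqP; rewrite eq_le -!emb_le ab lexx. Qed.

Lemma emb_gt0 (a : R) : (0 < std a) = (0 < a).
Proof. by rewrite -{1}emb0 emb_lt. Qed.

Lemma embV (a : R) : std a^-1 = (std a)^-1.
Proof.
have [->|a0] := eqVneq a 0; first by rewrite emb0 !invr0 emb0.
have sa0 : std a != 0 by apply: contra_neq a0 => sa; apply: emb_inj; rewrite sa emb0.
by apply: (mulfI sa0); rewrite -embM !divff // emb1.
Qed.

Lemma infml_fin x : infml x -> fin x.
Proof. by move=> [h]; exists 1; exact: h. Qed.

Lemma fin_le x y : `|x| <= `|y| -> fin y -> fin x.
Proof.
by move=> xy [K yK]; exists K; exact: le_lt_trans yK.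
Qed.

Lemma fin_std (a : R) : fin (std a).
Proof. by exists (`|a| + 1); rewrite -emb_norm emb_lt; lra. Qed.

Lemma finN x : fin x -> fin (- x).
Proof. by apply: fin_le; rewrite normrN. Qed.

Lemma finD x y : fin x -> fin y -> fin (x + y).
Proof.
move=> [K xK] [L yL]; exists (K + L).
by rewrite embD (le_lt_trans (ler_normD _ _)) // ltrD.
Qed.

Lemma finB x y : fin x -> fin y -> fin (x - y).
Proof. by move=> xf /finN; exact: finD. Qed.

Lemma infml_le x y : `|x| <= `|y| -> infml y -> infml x.
Proof.
move=> xy [h]; split=> e e0.
exact: le_lt_trans xy (h e e0).
Qed.

Lemma infmlN x : infml x -> infml (- x).
Proof. by apply: infml_le; rewrite normrN. Qed.

Lemma infmlD x y :
  infml x -> infml y -> infml (x + y).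
Proof.
move=> [hx] [hy]; split=> e e0.
have e2 : 0 < e / 2 by lra.
have -> : e = e / 2 + e / 2 by lra.
by rewrite embD (le_lt_trans (ler_normD _ _)) // ltrD ?hx ?hy.
Qed.

Lemma infmlB x y :
  infml x -> infml y -> infml (x - y).
Proof. by move=> xf /infmlN; exact: infmlD. Qed.

Lemma infml0 : infml (0 : F).
Proof. by split=> e e0; rewrite normr0 emb_gt0. Qed.

Lemma infml_std (a : R) : infml (std a) -> a = 0.
Proof.
move=> [h]; apply/eqP; rewrite -normr_le0 leNgt; apply/negP => a0.
by have := h _ a0; rewrite emb_norm ltxx.
Qed.

Lemma stdpart_unique x (r : R) : infml (x - std r) -> stdpart x = r.
Proof.
move=> xr; rewrite /stdpart; case: xgetP => [s _ xs|/(_ r) []//].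
apply/eqP; rewrite -subr_eq0; apply/eqP/infml_std.
have -> : std (s - r) = (x - std r) - (x - std s) by rewrite embB; ring.
exact: infmlB.
Qed.

Lemma stdpartP x : fin x -> infml (x - std (stdpart x)).
Proof.
move=> [K xK]; suff [r xr] : exists r, infml (x - std r).
  by rewrite (stdpart_unique xr).
(* The standard part is the supremum of the reals below x; finiteness of x makes this set nonempty
   and bounded. *)
pose S := [set r : R | std r <= x].
move: xK; rewrite ltr_norml => /andP[Kx xK].
have S0 : S (- K) by rewrite /S /= embN ltW.
have SK : ubound S K.
  by move=> r rx; rewrite -emb_le (le_trans rx) // ltW.
have hS : has_sup S by split; [exists (- K)|exists K].
exists (sup S); split=> e e0; rewrite ltr_norml; apply/andP; split.
  have [r rx er] := sup_adherent e0 hS.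
  rewrite ltrNl opprB ltrBlDr -ltrBlDl -embB; apply: lt_le_trans rx.
  by rewrite emb_lt.
rewrite ltrBlDl -embD ltNge; apply/negP => xe.
have : S (sup S + e) by [].
by move/(ub_le_sup hS.2); lra.
Qed.

Lemma stdpart_std (a : R) : stdpart (std a) = a.
Proof. by apply: stdpart_unique; rewrite subrr; exact: infml0. Qed.

Lemma stdpartD x y : fin x -> fin y -> stdpart (x + y) = stdpart x + stdpart y.
Proof.
move=> /stdpartP xs /stdpartP ys; apply: stdpart_unique.
have -> : x + y - std (stdpart x + stdpart y) =
    (x - std (stdpart x)) + (y - std (stdpart y)).
  by rewrite embD; ring.
exact: infmlD.
Qed.

Lemma stdpartN x : fin x -> stdpart (- x) = - stdpart x.
Proof.
move=> /stdpartP xs; apply: stdpart_unique.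
have -> : - x - std (- stdpart x) = - (x - std (stdpart x)) by rewrite embN; ring.
exact: infmlN.
Qed.

Lemma stdpartB x y : fin x -> fin y -> stdpart (x - y) = stdpart x - stdpart y.
Proof. by move=> xf yf; rewrite stdpartD ?stdpartN //; exact: finN. Qed.

Lemma stdpart_le (a : R) x : fin x -> x <= std a -> stdpart x <= a.
Proof.
move=> /stdpartP[xs] xa; rewrite leNgt; apply/negP => ax.
have /xs : 0 < stdpart x - a by rewrite subr_gt0.
rewrite embB ltr_norml => /andP[+ _]; lra.
Qed.

Lemma stdpart_ge (a : R) x : fin x -> std a <= x -> a <= stdpart x.
Proof.
move=> /stdpartP[xs] xa; rewrite leNgt; apply/negP => ax.
have /xs : 0 < a - stdpart x by rewrite subr_gt0.
rewrite embB ltr_norml => /andP[_ +]; lra.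
Qed.

Lemma stdpart_lt (a : R) x : fin x -> stdpart x < a -> x < std a.
Proof. by move=> xf; rewrite !ltNge; apply: contraNN => /(stdpart_ge xf). Qed.

Lemma stdpart_gt (a : R) x : fin x -> a < stdpart x -> std a < x.
Proof. by move=> xf; rewrite !ltNge; apply: contraNN => /(stdpart_le xf). Qed.

Lemma stdpart_infml x : infml x -> stdpart x = 0.
Proof. by move=> xi; apply: stdpart_unique; rewrite emb0 subr0. Qed.

Lemma negl_neq0 x y : negl x y -> y != 0.
Proof.
by move=> [/(_ 1 ltr01)]; apply: contraTneq => ->; rewrite normr0 mulr0 -leNgt.
Qed.

Lemma neglE x y : y != 0 -> negl x y <-> infml (x / y).
Proof.
move=> y0; have ny : 0 < `|y| by rewrite normr_gt0.
split=> [[h]|[h]]; split=> e e0.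
  by rewrite normrM normfV ltr_pdivrMr // h.
by have := h e e0; rewrite normrM normfV ltr_pdivrMr.
Qed.

Lemma domE x y : y != 0 -> dom x y <-> fin (x / y).
Proof.
move=> y0; have ny : 0 < `|y| by rewrite normr_gt0.
split=> [[K xK]|[K]].
  exists (K + 1); rewrite normrM normfV ltr_pdivrMr //.
  by rewrite embD emb1 mulrDl mul1r (le_lt_trans xK) // ltrDl.
by rewrite normrM normfV ltr_pdivrMr // => xK; exists K; exact: ltW.
Qed.

Lemma dom_pos x y : dom x y -> exists2 K : R, 0 < K & `|x| <= std K * `|y|.
Proof.
move=> [K xK]; exists (Num.max K 1); first by rewrite lt_max ltr01 orbT.
by rewrite (le_trans xK) // ler_wpM2r // emb_le le_max lexx.
Qed.

Lemma dom_refl x : dom x x.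
Proof. by exists 1; rewrite emb1 mul1r. Qed.

Lemma dom_neq0 x y : dom x y -> x != 0 -> y != 0.
Proof.
move=> [K xK] x0; apply: contraTneq xK => ->.
by rewrite normr0 mulr0 -ltNge normr_gt0.
Qed.

Lemma dom_trans y x z : dom x y -> dom y z -> dom x z.
Proof.
move=> /dom_pos[K K0 xK] [L yL]; exists (K * L).
by rewrite embM -mulrA (le_trans xK) // ler_pM2l // emb_gt0.
Qed.

Lemma negl_dom x y : negl x y -> dom x y.
Proof. by move=> [/(_ 1 ltr01)/ltW]; exists 1. Qed.

Lemma negl_domr x y z : negl x y -> dom y z -> negl x z.
Proof.
move=> [xy] /dom_pos[K K0 yK]; split=> e e0.
apply: lt_le_trans (xy (e / K) (divr_gt0 e0 K0)) _.
have -> : e = (e / K) * K by rewrite divfK // gt_eqF.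
rewrite mulfK ?gt_eqF // [leRHS](_ : _ = std (e / K) * (std K * `|z|)).
  by rewrite ler_wpM2l // ltW // emb_gt0 divr_gt0.
by rewrite mulrA -embM.
Qed.

Lemma dom_negl x y z : dom x y -> negl y z -> negl x z.
Proof.
move=> /dom_pos[K K0 yK] [yz]; split=> e e0; apply: le_lt_trans yK _.
have -> : e = K * (e / K) by rewrite mulrC divfK // gt_eqF.
by rewrite embM -mulrA ltr_pM2l ?emb_gt0 // yz // divr_gt0.
Qed.

Lemma negl_trans y x z : negl x y -> negl y z -> negl x z.
Proof. by move=> /negl_dom; exact: dom_negl. Qed.

Lemma neglD x y z : negl x z -> negl y z -> negl (x + y) z.
Proof.
move=> [xz] [yz]; split=> e e0; have e2 : 0 < e / 2 by lra.
have -> : e = e / 2 + e / 2 by lra.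
by rewrite embD mulrDl (le_lt_trans (ler_normD _ _)) // ltrD ?xz ?yz.
Qed.

Lemma neglN x z : negl x z -> negl (- x) z.
Proof. by move=> [xz]; split=> e e0; rewrite normrN xz. Qed.

Lemma neglB x y z : negl x z -> negl y z -> negl (x - y) z.
Proof. by move=> xz /neglN; exact: neglD. Qed.

Lemma negl0 z : z != 0 -> negl 0 z.
Proof. by move=> z0; split=> e e0; rewrite normr0 mulr_gt0 ?normr_gt0 // emb_gt0. Qed.

Lemma negl_irrefl x : ~ negl x x.
Proof. by move=> [/(_ 1 ltr01)]; rewrite emb1 mul1r ltxx. Qed.

Lemma negl_dom_false x y : negl x y -> dom y x -> False.
Proof. by move=> xy /(negl_domr xy)/negl_irrefl. Qed.

(** Together with [negl_dom_false], this says that [negl] is the strict part of the preorder [dom],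
    which is therefore total. Negating a smallness statement thus always yields a usable bound. *)
Lemma nnegl_dom x y : ~ negl x y -> dom y x.
Proof.
move=> nxy; have [e e0 xy] : exists2 e : R, 0 < e & std e * `|y| <= `|x|.
  apply: contrapT => H; apply: nxy; split=> e e0; rewrite ltNge; apply/negP => xy.
  by apply: H; exists e.
by exists e^-1; rewrite embV ler_pdivlMl // emb_gt0.
Qed.

Lemma le_dom x y : `|x| <= `|y| -> dom x y.
Proof. by move=> xy; exists 1; rewrite emb1 mul1r. Qed.

Lemma negl_lt x y : negl x y -> `|x| < `|y|.
Proof. by move=> [/(_ 1 ltr01)]; rewrite emb1 mul1r. Qed.

Lemma negl_stdpart x a : a != 0 -> dom x a ->
  negl (x - std (stdpart (x / a)) * a) a.
Proof.
move=> a0 /(domE _ a0)/stdpartP h; apply/neglE => //.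
by rewrite mulrBl mulfK.
Qed.

Lemma stdpart_negl x a (c : R) : negl (x - std c * a) a -> stdpart (x / a) = c.
Proof.
move=> h; have a0 := negl_neq0 h; apply: stdpart_unique.
by move/(neglE _ a0): h; rewrite mulrBl mulfK.
Qed.

Lemma stdpart_neq0 x a : x != 0 -> dom x a -> dom a x -> stdpart (x / a) != 0.
Proof.
move=> x0 xa ax; have a0 := dom_neq0 xa x0.
apply/eqP => c0; have := negl_stdpart a0 xa.
by rewrite c0 emb0 mul0r subr0 => /negl_dom_false; exact.
Qed.

Lemma negl_sub_dom x y : x != 0 -> negl (x - y) x ->
  [/\ y != 0, dom x y & dom y x].
Proof.
move=> x0 xy.
have yx : dom y x.
  case: (negl_dom xy) => K hK; exists (1 + K); rewrite embD emb1 mulrDl mul1r.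
  rewrite -[y in leLHS](subKr x); apply: le_trans (ler_normB _ _) _.
  by rewrite lerD2l.
have {}xy : dom x y.
  apply: nnegl_dom => nyx; apply: (@negl_irrefl x).
  by rewrite -[x in negl x](subrK y); exact: neglD.
by split=> //; exact: dom_neq0 x0.
Qed.

Lemma negl_subl b x y z : negl (x - b) z -> negl (x - y) z -> negl (y - b) z.
Proof.
move=> xb xy; have -> : y - b = (x - b) - (x - y) by ring.
exact: neglB.
Qed.

Lemma negl_subr b x y z : negl (x - b) z -> negl (y - b) z -> negl (x - y) z.
Proof.
move=> xb yb; have -> : x - y = (x - b) - (y - b) by ring.
exact: neglB.
Qed.

Lemma negl_multiple e x a : e != 0 -> negl (x - std e * a) a ->
  [/\ x != 0, dom x a & dom a x].
Proof.
move=> e0 xa; have a0 := negl_neq0 xa.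
have se0 : std e != 0 by apply: contra_neq e0 => se; apply: emb_inj; rewrite se emb0.
have d1 : dom (std e * a) a.
  by exists `|e|; rewrite normrM emb_norm.
have d2 : dom a (std e * a).
  exists `|e^-1|; rewrite normrM mulrA emb_norm embV -normrM mulVf //.
  by rewrite normr1 mul1r.
have ea0 : std e * a != 0 by rewrite mulf_neq0.
have [|x0 ex xe] := @negl_sub_dom (std e * a) x ea0.
  by rewrite -opprB; apply/neglN/(negl_domr xa).
by split=> //; [exact: dom_trans xe d1|exact: dom_trans d2 ex].
Qed.

Lemma negl_shift x y a c d : negl (x - std c * a) a -> negl (y - std d * a) a ->
  negl (x - y - std (c - d) * a) a.
Proof.
move=> xa ya; have -> : x - y - std (c - d) * a =
    (x - std c * a) - (y - std d * a) by rewrite embB; ring.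
exact: neglB.
Qed.

Lemma negl_swap x y a c : negl (x - y - std c * a) a ->
  negl (y - x - std (- c) * a) a.
Proof.
move=> xa; have -> : y - x - std (- c) * a = - (x - y - std c * a).
  by rewrite embN; ring.
exact: neglN.
Qed.

Lemma ndom_negl x y : ~ dom y x -> negl x y.
Proof. by move=> nyx; apply: contrapT => /nnegl_dom. Qed.

Lemma domN x y : dom x y -> dom (- x) y.
Proof. by case=> K xK; exists K; rewrite normrN. Qed.

Lemma domNr x y : dom x y -> dom x (- y).
Proof. by case=> K xK; exists K; rewrite normrN. Qed.

Lemma neglC x y z : negl (x - y) z -> negl (y - x) z.
Proof. by move=> xy; rewrite -opprB; exact: neglN. Qed.

End StandardPart.
Arguments fin {R F} std x.
Arguments infml {R F} std x.
Arguments stdpart {R F} std x.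
Arguments dom {R F} std x y.
Arguments negl {R F} std x y.

(** * Archimedean classes of hyperreals *)

Section Lambda.
Context {R : realType} {M : nonstandard_model R}.
Local Notation hR := (hyperreal M).
Implicit Types x y z : hR.
Local Notation std := (hstd M).
Local Notation dom := (@dom R _ std).
Local Notation negl := (@negl R _ std).

#[export] Instance hstd_embedding : order_embedding std := {
  embD := hstdD; embN := hstdN; embM := hstdM; emb1 := erefl; emb_le := hstd_le }.

Lemma hfiniteE x : hfinite x <-> fin std x.
Proof. by split=> -[K xK]; exists K; exact/hltE. Qed.

Lemma infinitesimalE x : infinitesimal x <-> infml std x.
Proof. by split=> [h|[h]]; [split|] => e e0; apply/hltE/h. Qed.

Lemma stE x : st x = stdpart std x.
Proof.
rewrite /st /stdpart; congr xget; apply/funext => r; apply/propext.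
by rewrite /= hsubE; exact: infinitesimalE.
Qed.

Lemma lamP x y : x != 0 -> lam x y <-> [/\ y != 0, dom x y & dom y x].
Proof.
move=> x0; rewrite /lam /arch_equiv /=; split=> [[/eqP y0]|[y0]].
  by rewrite !hdivE => -[/hfiniteE/(domE _ y0) ? /hfiniteE/(domE _ x0) ?].
move=> /(domE _ y0)/hfiniteE xy /(domE _ x0)/hfiniteE yx; split; first exact/eqP.
by split; rewrite hdivE; [exact: xy|exact: yx].
Qed.

Lemma lam_refl x : x != 0 -> lam x x.
Proof. by move=> x0; apply/lamP => //; split=> //; exact: dom_refl. Qed.

Lemma lam_eq x y : x != 0 -> y != 0 -> lam x = lam y <-> dom x y /\ dom y x.
Proof.
move=> x0 y0; split=> [xy|[xy yx]].
  by have := lam_refl y0; rewrite -xy => /(lamP _ x0)[].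
apply/seteqP; split=> z /lamP[//|z0 h k]; apply/lamP => //.
  by split=> //; [exact: dom_trans h|exact: dom_trans k _].
by split=> //; [exact: dom_trans h|exact: dom_trans k _].
Qed.

Lemma lam_ltE x y : x != 0 -> y != 0 -> lam_lt (lam x) (lam y) <-> negl x y.
Proof.
move=> x0 y0; split.
  move=> [nxy [x' [y' [/lamP[//|x'0 xx' x'x] /lamP[//|y'0 yy' y'y] lxy]]]].
  have {}lxy : `|x'| <= `|y'| by apply/ltW/hltE.
  have x'y' : dom x' y' by exact: le_dom.
  apply: contrapT => /nnegl_dom yx; apply: nxy; apply/lam_eq => //; split=> //.
  exact: dom_trans (dom_trans xx' x'y') y'y.
move=> xy; split.
  by move=> /lam_eq[//|//|_]; exact: negl_dom_false.
exists x, y; split; [exact: lam_refl|exact: lam_refl|apply/hltE].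
exact: negl_lt.
Qed.

End Lambda.

(** * The decomposition *)

Lemma subr_cancel (V : zmodType) (x y z t : V) : z = t -> x - z - (y - t) = x - y.
Proof. by move=> ->; rewrite opprB addrA subrK. Qed.

Section WellOrder.
Context {W : Type} {Q : rel W} (wQ : wochoice.well_order Q).

Lemma wo_min (P : set W) : P !=set0 -> exists2 z, P z & forall y, P y -> Q z y.
Proof.
move=> [x Px]; have [|z [[/asboolP Pz zP] _]] := wQ (A := [pred y | `[< P y >]]).
  by exists x; apply/asboolP.
by exists z => // y Py; apply: zP; apply/asboolP.
Qed.

Lemma wo_refl i : Q i i.
Proof. by have [z -> ->] := wo_min (P := [set i]) (ex_intro _ i erefl). Qed.

(** [well_order] provides unique minima of nonempty sets. If i and j are each below the other, both
    are minima of the pair {i, j}. *)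
Lemma wo_anti i j : Q i j -> Q j i -> i = j.
Proof.
move=> ij ji; have [|z [_ zu]] := wQ (A := [pred k | `[< k = i \/ k = j >]]).
  by exists i; apply/asboolP; left.
transitivity z.
  symmetry; apply: zu; split; first by apply/asboolP; left.
  by move=> k /asboolP[] -> //; exact: wo_refl.
apply: zu; split; first by apply/asboolP; right.
by move=> k /asboolP[] -> //; exact: wo_refl.
Qed.

Lemma strict_irrefl i : ~ strict Q i i.
Proof. by rewrite /strict wo_refl. Qed.

Lemma strict_trans j i k : strict Q i j -> strict Q j k -> strict Q i k.
Proof.
rewrite /strict => nji nkj; apply/negP => ki.
have [|z [[->|->]|->] zP] := wo_min (P := [set l | (l = i \/ l = j) \/ l = k]).
- by exists i; left; left.
- move: nkj; rewrite (wo_anti ki (zP k _)); last by right.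
  by rewrite zP //; left; right.
- by move: nji; rewrite zP //; left; left.
- by move: nkj; rewrite zP //; left; right.
Qed.

Lemma strict_total i j : [\/ strict Q i j, i = j | strict Q j i].
Proof.
rewrite /strict; case ji : (Q j i); last by constructor 1.
by case ij : (Q i j); [constructor 2; exact: wo_anti|constructor 3].
Qed.

End WellOrder.

Section Stages.
Context {R : realType} {M : nonstandard_model R} {prec : rel (hyperreal M)}.
Hypothesis prec_wo : wochoice.well_order prec.
Local Notation hR := (hyperreal M).
Local Notation std := (hstd M).
Local Notation dom := (@dom R _ std).
Local Notation negl := (@negl R _ std).
Local Notation rep := (@rep_of R M prec).
Local Notation lead := (@lead R M prec).
Implicit Types x y : hR.

Lemma prec_minP (P : set hR) : P !=set0 -> P (prec_min prec P).
Proof.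
move=> /(wo_min prec_wo)[z Pz zP]; rewrite /prec_min.
by case: xgetP => [y _ []//|/(_ z)[]].
Qed.

Lemma lam_rep x : x != 0 -> lam x (rep (lam x)).
Proof.
move=> x0; rewrite /rep_of; case: asboolP => [->|_].
  exact/lam_refl/oner_neq0.
by apply: prec_minP; exists x; exact: lam_refl.
Qed.

Lemma repP x : x != 0 ->
  [/\ rep (lam x) != 0, dom x (rep (lam x)) & dom (rep (lam x)) x].
Proof. by move=> x0; apply/lamP => //; exact: lam_rep. Qed.

Lemma leading_coefE x : leading_coef prec x = stdpart std (x / rep (lam x)).
Proof. by rewrite /leading_coef stE hdivE. Qed.

Lemma remainderE x :
  remainder prec x = x - std (leading_coef prec x) * rep (lam x).
Proof. exact: hsubE. Qed.

Lemma leading_coef_neq0 x : x != 0 -> leading_coef prec x != 0.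
Proof. by move=> x0; have [_ h k] := repP x0; rewrite leading_coefE stdpart_neq0. Qed.

Lemma negl_remainder x : x != 0 -> negl (remainder prec x) x.
Proof.
move=> x0; have [a0 h k] := repP x0; rewrite remainderE leading_coefE.
exact: negl_domr (negl_stdpart a0 h) k.
Qed.

(** The representative depends only on the class, and adding o(x) changes neither the class of x nor
    the standard part of its quotient by the representative. [lead_negl] is the converse. *)
Lemma negl_lead x y : x != 0 -> negl (x - y) x -> y != 0 /\ lead y = lead x.
Proof.
move=> x0 xy; have [y0 xy' yx'] := negl_sub_dom x0 xy; split=> //.
have lxy : lam y = lam x by apply/lam_eq.
suff cxy : leading_coef prec y = leading_coef prec x by rewrite /Defs.lead lxy cxy.
have [a0 h k] := repP x0; rewrite !leading_coefE lxy; apply: stdpart_negl.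
by apply: (negl_subl (negl_stdpart a0 h)); exact: negl_domr h.
Qed.

Lemma lead_negl x y : x != 0 -> y != 0 -> lead x = lead y -> negl (x - y) x.
Proof.
move=> x0 y0 xy.
have cxy : leading_coef prec x = leading_coef prec y := congr1 fst xy.
have lxy : lam x = lam y := congr1 snd xy.
have [_ yx] := proj1 (lam_eq x0 y0) lxy.
have := negl_remainder x0; rewrite remainderE cxy lxy => hx; apply: (negl_subr hx).
by rewrite -remainderE; exact: negl_domr (negl_remainder y0) yx.
Qed.

Lemma remainder_sub x y : lead x = lead y ->
  remainder prec x - remainder prec y = x - y.
Proof.
move=> xy; apply: etrans (congr2 _ (remainderE x) (congr1 _ (remainderE y))) _.
exact: subr_cancel (congr1 (fun p : R * set hR => std p.1 * rep p.2) xy).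
Qed.

Section Fixed.
Context {W : Type} {Q : rel W} (wQ : wochoice.well_order Q).
Local Notation stage := (stage prec wQ).

Definition running i x := forall j, strict Q j i -> stage j x != 0.

Definition companions i x : set hR := [set y | forall j (_ : strict Q j i),
  stage j y <> hzero /\ lead (stage j y) = lead (stage j x)].

(** The three cases of the recursion, free of its choice of a predecessor. After the first index,
    values are described only while the process runs, because a stopped process stays at 0. *)
Variant stage_spec i : Prop :=
  | StageFirst of (forall j, ~ strict Q j i) & (forall x, stage i x = x)
  | StageSucc p of strict Q p i & (forall k, strict Q k i -> ~ strict Q p k) &
      (forall x, running i x -> stage i x = remainder prec (stage p x))
  | StageLimit of (exists j, strict Q j i) &
      (forall p, strict Q p i -> exists2 k, strict Q k i & strict Q p k) &
      forall x, running i x -> stage i x = x - prec_min prec (companions i x).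

Lemma stageP i : stage_spec i.
Proof.
have run x : running i x -> ~ exists j (_ : strict Q j i), stage j x = hzero.
  by move=> rx [j [/rx/eqP]].
have [n0|n0] := pselect (forall j, ~ strict Q j i).
  apply: StageFirst => // x; rewrite stageE /stage_step.
  case: (pselect (exists j (_ : strict Q j i), stage j x = hzero)) => [[j [ji]]|n1].
    by case: (n0 j).
  by case: (pselect (forall j, ~ strict Q j i)).
have E x : running i x -> stage i x =
    match pselect (exists j, strict Q j i /\
                     forall k, strict Q k i -> ~ strict Q j k) with
    | left h => remainder prec (stage (sval (cid h)) x)
    | right _ => hsub x (prec_min prec (companions i x))
    end.
  move=> /run nrun; rewrite stageE /stage_step.
  case: (pselect (exists j (_ : strict Q j i), stage j x = hzero)) => // n1.
  by case: (pselect (forall j, ~ strict Q j i)).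
case: pselect E => [h|n1] E; last first.
  apply: StageLimit => [|p pi|x /E ->]; last exact: hsubE.
    by apply: contrapT => H; apply: n0 => j ji; apply: H; exists j.
  apply: contrapT => H; apply: n1; exists p; split=> // k ki pk.
  by apply: H; exists k.
have [pi pmax] := svalP (cid h).
exact: StageSucc pi pmax E.
Qed.

Definition agree (i : W) x y := forall j, strict Q j i ->
  [/\ stage j x != 0, stage j y != 0 & lead (stage j x) = lead (stage j y)].

Lemma agree_trans i j x y : strict Q j i -> agree i x y -> agree j x y.
Proof. by move=> ji ag k kj; apply: ag; exact: strict_trans ji. Qed.

(** At a successor, the same multiple of the same representative is subtracted from both numbers. At
    a limit, x and y have the same companions, hence the same minimum is subtracted. *)
Lemma stage_agree i x y : agree i x y -> stage i x - stage i y = x - y.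
Proof.
elim/(well_founded_ind (strict_wf wQ)): i => i IH ag.
have rx : running i x by move=> j /ag[].
have ry : running i y by move=> j /ag[].
case: (stageP i) => [_ E|p pi _ E|_ _ E]; rewrite !E //.
  have [_ _ xy] := ag p pi.
  by rewrite (remainder_sub xy); exact: IH (agree_trans pi ag).
apply/subr_cancel/(congr1 (prec_min prec))/funext => z; apply/propext.
split=> H j ji; have [h1 h2] := H j ji; have [_ _ e] := ag j ji.
  by split; [exact: h1|exact: etrans h2 e].
by split; [exact: h1|exact: etrans h2 (esym e)].
Qed.

Lemma stage_running i x : stage i x != 0 -> running i x.
Proof.
move=> + j ji; apply: contra_neq => j0; rewrite stageE /stage_step.
case: (pselect (exists j (_ : strict Q j i), stage j x = hzero)) => // -[].
by exists j, ji.
Qed.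

Lemma stage_stopped i x : ~ running i x -> stage i x = 0.
Proof.
move=> /existsNP[j /not_implyP[ji /negP]]; rewrite negbK => /eqP j0.
rewrite stageE /stage_step.
case: (pselect (exists j (_ : strict Q j i), stage j x = hzero)) => // -[].
by exists j, ji.
Qed.

(** At a limit, stage i of x is x - a, where a is a companion of x (companions exist, as x is one).
    For j < i, the stages of x and a at j have the same leading term, so their difference is
    negligible against stage j of x; by [stage_agree] this difference is x - a. *)
Lemma stage_decr i j x : strict Q j i -> stage i x != 0 ->
  negl (stage i x) (stage j x).
Proof.
elim/(well_founded_ind (strict_wf wQ)): i j => i IH j ji i0.
have rx := stage_running i0.
case: (stageP i) => [/(_ j)//|p pi pmax E|_ _ E]; rewrite (E x rx).
  have rp := negl_remainder (rx p pi).
  have [jp|->//|pj] := strict_total wQ j p; last by case: (pmax j ji).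
  by apply: negl_trans rp _; apply: IH => //; exact: rx.
have aP : companions i x (prec_min prec (companions i x)).
  by apply: prec_minP; exists x => k ki; split=> //; apply/eqP; exact: rx.
have ag : agree i x (prec_min prec (companions i x)).
  move=> k ki; have [/eqP h1 h2] := aP k ki.
  by split; [exact: rx|exact: h1|exact: esym h2].
have [x0 a0 xa] := ag j ji.
by have := lead_negl x0 a0 xa; rewrite (stage_agree (agree_trans ji ag)).
Qed.

(** What is negligible against stage i is negligible against all earlier stages, which are larger.
    So the induction gives agreement below i, and then the two stages at i still differ by x - y. *)
Lemma negl_agree i x y : stage i x != 0 -> negl (x - y) (stage i x) ->
  [/\ agree i x y, stage i y != 0 & lead (stage i y) = lead (stage i x)].
Proof.
elim/(well_founded_ind (strict_wf wQ)): i => i IH i0 xy.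
have ag : agree i x y.
  move=> j ji; have j0 := stage_running i0 ji.
  have [_ h1 h2] := IH j ji j0 (negl_trans xy (stage_decr ji i0)).
  by split; [exact: j0|exact: h1|exact: esym h2].
have [] := negl_lead (y := stage i y) i0; last by split.
by rewrite (stage_agree ag).
Qed.

End Fixed.

(* [same_type i i']: the initial segments below i and i' have the same order type. *)
Section Same.
Context {W W' : Type} {Q : rel W} {Q' : rel W'}.
Hypotheses (wQ : wochoice.well_order Q) (wQ' : wochoice.well_order Q').

Definition same_type_step (i : W) (E : forall j, strict Q j i -> W' -> Prop)
    (i' : W') : Prop :=
  (forall j (ji : strict Q j i), exists2 j', strict Q' j' i' & E j ji j') /\
  (forall j', strict Q' j' i' -> exists j (ji : strict Q j i), E j ji j').

Definition same_type : W -> W' -> Prop :=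
  Fix (strict_wf wQ) (fun _ => W' -> Prop) same_type_step.

Lemma same_typeE i i' : same_type i i' <->
  (forall j, strict Q j i -> exists2 j', strict Q' j' i' & same_type j j') /\
  (forall j', strict Q' j' i' -> exists2 j, strict Q j i & same_type j j').
Proof.
rewrite {1}/same_type Fix_eq; last first.
  move=> j E E' EE'; have -> // : E = E'.
  by apply: functional_extensionality_dep => k; apply/funext => h; exact: EE'.
split=> -[H K]; split=> // j' ji'.
  by have [j [ji h]] := K j' ji'; exists j.
by have [j ji h] := K j' ji'; exists j, ji.
Qed.

Lemma same_type_total i i' : [\/ same_type i i',
  exists2 j, strict Q j i & same_type j i' |
  exists2 j', strict Q' j' i' & same_type i j'].
Proof.
elim/(well_founded_ind (strict_wf wQ)): i i' => i IHi.
elim/(well_founded_ind (strict_wf wQ')) => i' IHi'.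
have [H|] := pselect (forall j, strict Q j i ->
    exists2 j', strict Q' j' i' & same_type j j'); last first.
  move=> /existsNP[j /not_implyP[ji nj]].
  have [h|[k kj h]|h//] := IHi j ji i'; first by constructor 2; exists j.
  by constructor 2; exists k => //; exact: strict_trans kj ji.
have [K|] := pselect (forall j', strict Q' j' i' ->
    exists2 j, strict Q j i & same_type j j'); last first.
  move=> /existsNP[j' /not_implyP[ji' nj]].
  have [h|h//|[k' kj' h]] := IHi' j' ji'; first by constructor 3; exists j'.
  by constructor 3; exists k' => //; exact: strict_trans kj' ji'.
by constructor 1; apply/same_typeE.
Qed.

Lemma same_type_inj j k l' : same_type j l' -> same_type k l' -> j = k.
Proof.
elim/(well_founded_ind (strict_wf wQ')): l' j k => l' IH j k.
move=> /same_typeE[jl lj] /same_typeE[kl lk].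
have [jk|//|kj] := strict_total wQ j k.
  have [m' ml jm] := kl _ jk; have [i ij im] := lj _ ml.
  by case: (strict_irrefl wQ (i := j)); rewrite {1}(IH m' ml _ _ jm im).
have [m' ml km] := jl _ kj; have [i ik im] := lk _ ml.
by case: (strict_irrefl wQ (i := k)); rewrite {1}(IH m' ml _ _ km im).
Qed.

Lemma same_type_injr j k' l' : same_type j k' -> same_type j l' -> k' = l'.
Proof.
elim/(well_founded_ind (strict_wf wQ)): j k' l' => j IH k' l'.
move=> /same_typeE[jk kj] /same_typeE[jl lj].
have [kl|//|lk] := strict_total wQ' k' l'.
  have [m mj mk] := lj _ kl; have [i' ik im] := jk _ mj.
  by case: (strict_irrefl wQ' (i := k')); rewrite {1}(IH m mj _ _ mk im).
have [m mj ml] := kj _ lk; have [i' il im] := jl _ mj.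
by case: (strict_irrefl wQ' (i := l')); rewrite {1}(IH m mj _ _ ml im).
Qed.

Lemma same_type_mono j k j' k' : same_type j j' -> same_type k k' ->
  strict Q j k -> strict Q' j' k'.
Proof.
by move=> jj' /same_typeE[H _] /H[l' lk jl]; rewrite (same_type_injr jj' jl).
Qed.

Lemma same_type_monor j k j' k' : same_type j j' -> same_type k k' ->
  strict Q' j' k' -> strict Q j k.
Proof.
by move=> jj' /same_typeE[_ H] /H[l lk jl]; rewrite (same_type_inj jj' jl).
Qed.

(** This makes a stage a function of an ordinal, so that coefficients found in different
    well-ordered types can be compared. Being first, successor or limit depends on the order type
    alone, which rules out the mixed cases. *)
Lemma stage_same_type i i' x :
  same_type i i' -> stage prec wQ i x = stage prec wQ' i' x.
Proof.
elim/(well_founded_ind (strict_wf wQ)): i i' x => i IH i' x /same_typeE[H K].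
have [rx|nrx] := pselect (running wQ i x); last first.
  rewrite !stage_stopped // => rx; apply: nrx => j ji.
  by have [j' ji' jj'] := H j ji; rewrite (IH _ _ _ _ jj') //; exact: rx.
have rx' : running wQ' i' x.
  by move=> j' /K[j ji jj']; rewrite -(IH _ _ _ _ jj') //; exact: rx.
case: (stageP wQ i) (stageP wQ' i')
    => [n0 E|p pi pmax E|[l li] lim E] [n0' E'|p' pi' pmax' E'|[l' li'] lim' E'].
- by rewrite E E'.
- by have [j /n0] := K p' pi'.
- by have [j /n0] := K l' li'.
- by have [j' /n0'] := H p pi.
- suff pp' : same_type p p'.
    rewrite (E x rx) (E' x rx').
    exact: (congr1 (remainder prec) (IH p pi p' x pp')).
  have [k ki kp'] := K p' pi'; have [q' qi' pq'] := H p pi.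
  have [kp|<-//|pk] := strict_total wQ k p; last by case: (pmax k ki).
  by case: (pmax' q' qi'); exact: same_type_mono kp' pq' kp.
- have [q' qi' pq'] := H p pi; have [k' ki' qk'] := lim' q' qi'.
  have [k ki kk'] := K k' ki'; case: (pmax k ki).
  exact: same_type_monor pq' kk' qk'.
- by have [j' /n0'] := H l li.
- have [q qi qp'] := K p' pi'; have [k ki qk] := lim q qi.
  have [k' ki' kk'] := H k ki; case: (pmax' k' ki').
  exact: same_type_mono qp' kk' qk.
- have e j j' : strict Q j i -> same_type j j' ->
      stage prec wQ j = stage prec wQ' j'.
    by move=> ji jj'; apply/funext => y; exact: IH jj'.
  suff CC : companions wQ i x = companions wQ' i' x.
    rewrite (E x rx) (E' x rx').
    exact: (congr1 (fun P => x - prec_min prec P) CC).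
  apply/funext => y; apply/propext; split=> C.
    by move=> j' /K[j ji jj']; have := C j ji; rewrite (e j j' ji jj').
  move=> j ji; have [j' ji' jj'] := H j ji.
  by have := C j' ji'; rewrite -(e j j' ji jj').
Qed.

End Same.

(** * Coefficients of two numbers near the class of their difference *)

Local Notation coef := (coef prec).

Definition occurs x (l : set hR) (c : R) : Prop :=
  exists (W : Type) (Q : rel W) (wQ : wochoice.well_order Q) (i : W),
    stage prec wQ i x <> hzero /\ lead (stage prec wQ i x) = (c, l).

Lemma occursP x l c : occurs x l c ->
  exists (W : Type) (Q : rel W) (wQ : wochoice.well_order Q) (i : W),
    [/\ stage prec wQ i x != 0, leading_coef prec (stage prec wQ i x) = c &
        lam (stage prec wQ i x) = l].
Proof.
move=> [W [Q [wQ [i [/eqP h k]]]]]; exists W, Q, wQ, i; split; first exact: h.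
  exact: (congr1 (@fst R (set hR)) k).
exact: (congr1 (@snd R (set hR)) k).
Qed.

Lemma stage_lam_inj (W : Type) (Q : rel W) (wQ : wochoice.well_order Q) i j x :
  stage prec wQ i x != 0 -> strict Q j i ->
  lam (stage prec wQ i x) <> lam (stage prec wQ j x).
Proof.
move=> i0 ji /lam_eq[||_]; [exact: i0|exact: stage_running i0 _ ji|].
by apply: negl_dom_false; exact: stage_decr.
Qed.

(** If the two indices have different order types, the smaller one is matched with an index strictly
    below the larger one, and one process would meet the same class twice. *)
Lemma occurs_unique x l c c' : occurs x l c -> occurs x l c' -> c = c'.
Proof.
move=> /occursP[W [Q [wQ [i [i0 <- il]]]]] /occursP[W' [Q' [wQ' [i' [i0' <- il']]]]].
have [h|[j ji h]|[j' ji' h]] := same_type_total wQ wQ' i i'.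
- by rewrite (stage_same_type wQ' x h).
- case: (stage_lam_inj i0 ji).
  by rewrite (stage_same_type wQ' x h); exact: etrans il (esym il').
- case: (stage_lam_inj i0' ji').
  by rewrite -(stage_same_type wQ' x h); exact: etrans il' (esym il).
Qed.

Lemma coefP x l c : occurs x l c -> coef x l = c.
Proof.
move=> xlc; rewrite /Defs.coef; case: xgetP => [c' _ h|/(_ c)[]//].
exact: occurs_unique h xlc.
Qed.

Lemma coef_occurs x l : coef x l != 0 -> occurs x l (coef x l).
Proof. by rewrite /Defs.coef; case: xgetP => [c _ //|]; rewrite eqxx. Qed.

Lemma occurs_neq0 x l c : occurs x l c -> c != 0.
Proof.
by move=> /occursP[W [Q [wQ [i [i0 <- _]]]]]; exact: leading_coef_neq0.
Qed.

Lemma occurs_close x y z c : z != 0 -> negl (x - y) z ->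
  occurs x (lam z) c -> occurs y (lam z) c.
Proof.
move=> z0 xyz [W [Q [wQ [i [/eqP i0 ic]]]]].
have il : lam z = lam (stage prec wQ i x) := esym (congr1 (@snd R (set hR)) ic).
have [zi _] := proj1 (lam_eq z0 i0) il.
have [_ iy0 iy] := negl_agree i0 (negl_domr xyz zi).
exists W, Q, wQ, i; split; first exact/eqP.
exact: etrans iy ic.
Qed.

(** A term of x at the class of z belongs to a stage of the magnitude of z, against which x - y is
    negligible, so y has the same term. By symmetry, a class that occurs for neither number gives
    both the default coefficient 0. *)
Lemma coef_close x y z : z != 0 -> negl (x - y) z -> coef x (lam z) = coef y (lam z).
Proof.
move=> z0 xyz; rewrite /Defs.coef.
suff E : occurs x (lam z) = occurs y (lam z) by exact: (congr1 (xget 0) E).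
apply/funext => c; apply/propext; split; apply: occurs_close => //.
exact: neglC.
Qed.

(** The stages of x before the class of D = x - y are much larger than D, so both processes agree up
    to there. With a the representative of that class, d the leading coefficient of D and x_i = c a
    + o(a), the stage of y is y_i = x_i - D = (c - d) a + o(a). This exhibits a leading term of y
    unless c = d. *)
Lemma occurs_shift x y c : x - y != 0 -> occurs x (lam (x - y)) c ->
  c = leading_coef prec (x - y) \/
  occurs y (lam (x - y)) (c - leading_coef prec (x - y)).
Proof.
move=> D0 /occursP[W [Q [wQ [i [i0 ic il]]]]].
set d := leading_coef prec (x - y); have [|cd] := eqVneq c d; first by left.
right; have [Di iD] := proj1 (lam_eq D0 i0) (esym il).
have ag : agree wQ i x y.
  move=> j ji; have j0 := stage_running i0 ji.
  have [_ h1 h2] := negl_agree j0 (dom_negl Di (stage_decr ji i0)).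
  by split; [exact: j0|exact: h1|exact: esym h2].
have Dd := negl_remainder D0; have ii := negl_remainder i0.
have [a0 Da aD] := repP D0; set a := rep (lam (x - y)) in a0 Da aD.
have {}Dd : negl (x - y - std d * a) a.
  by rewrite -remainderE; exact: negl_domr Dd Da.
have {}ii : negl (stage prec wQ i x - std c * a) a.
  move: ii; rewrite remainderE ic il => ii.
  exact: negl_domr ii (dom_trans iD Da).
have iy : negl (stage prec wQ i y - std (c - d) * a) a.
  have -> : stage prec wQ i y = stage prec wQ i x - (x - y).
    by rewrite -(stage_agree ag) subKr.
  exact: negl_shift.
have [y0 ya ay] := negl_multiple (contra_neq (@subr0_eq _ _ _) cd) iy.
have lyD : lam (stage prec wQ i y) = lam (x - y).
  by apply/lam_eq => //; split; [exact: dom_trans ya aD|exact: dom_trans Da ay].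
exists W, Q, wQ, i; split; first exact/eqP.
rewrite /Defs.lead lyD leading_coefE lyD; apply: congr2 => //.
exact: stdpart_negl.
Qed.

(* The process stops by cardinality: it cannot run through a well-ordering of the
   power set of the set of classes, as the classes met are distinct. *)
Lemma occurs_exists x y : x - y != 0 -> exists c,
  occurs x (lam (x - y)) c \/ occurs y (lam (x - y)) c.
Proof.
move=> D0.
have [Q wQ] := wochoice.well_ordering_principle {classic set (set hR)}.
pose same_lead i := [/\ stage prec wQ i x != 0, stage prec wQ i y != 0 &
  lead (stage prec wQ i x) = lead (stage prec wQ i y)].
have [i0 [ni0 mini]] : exists i, ~ same_lead i /\ forall j, strict Q j i -> same_lead j.
  have [alli|] := pselect (forall i, same_lead i); last first.
    move=> /existsNP ne; have [i ni mini] := wo_min wQ ne.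
    exists i; split=> // j; rewrite /strict => ji; apply: contrapT => nj.
    by move: ji; rewrite mini.
  exfalso; pose f (i : set (set hR)) := lam (stage prec wQ i x).
  have f_inj i j : f i = f j -> i = j.
    move=> fij; have [ij|//|ji] := strict_total wQ i j.
      by case: (@stage_lam_inj _ _ wQ j i x); [case: (alli j)|exact: ij|exact: esym fij].
    by case: (@stage_lam_inj _ _ wQ i j x); [case: (alli i)|exact: ji|exact: fij].
  (* Cantor's diagonal set: [f] would inject the power set of [set hR] into [set hR]. *)
  pose A : set (set hR) := [set t | exists B, f B = t /\ ~ B t].
  have nA : ~ A (f A).
    by move=> AfA; have [B [/f_inj BA nB]] := AfA; apply: nB; rewrite BA.
  by apply: (nA); exists A; split.
have ag : agree wQ i0 x y by [].
have D := stage_agree ag.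
apply: contrapT => H.
have nx : stage prec wQ i0 x != 0 -> lam (stage prec wQ i0 x) <> lam (x - y).
  move=> u0 ul; apply: H; exists (leading_coef prec (stage prec wQ i0 x)).
  left; exists _, Q, wQ, i0; split; first exact/eqP.
  exact: (congr1 (pair _) ul).
have ny : stage prec wQ i0 y != 0 -> lam (stage prec wQ i0 y) <> lam (x - y).
  move=> u0 ul; apply: H; exists (leading_coef prec (stage prec wQ i0 y)).
  right; exists _, Q, wQ, i0; split; first exact/eqP.
  exact: (congr1 (pair _) ul).
move: D nx ny ni0; rewrite /same_lead.
move: (stage prec wQ i0 x) (stage prec wQ i0 y) => u v D nx ny nl.
(* At the first stage without a common leading term, u - v = D, and neither u nor v has the class of
   D. If one of them is 0, the other is D up to sign. If D is O(u), then D = o(u) since the classes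
   differ, so u and v have the same leading term after all. Hence u, and likewise v, is o(D), and so
   is D itself. *)
have [u0|u0] := eqVneq u 0.
  have vD : - v = x - y by rewrite -D u0 add0r.
  have v0 : v != 0 by rewrite -oppr_eq0 vD.
  apply: (ny v0); apply/lam_eq; [exact: v0|exact: D0|rewrite -vD].
  by split; [apply: domNr|apply: domN]; exact: dom_refl.
have [v0|v0] := eqVneq v 0.
  by apply: (nx u0); rewrite -D v0 subr0.
have uD : negl u (x - y).
  apply: ndom_negl => Du; apply: nx => //; apply/lam_eq => //; split=> //.
  apply: nnegl_dom => nDu; apply: nl; split=> //.
  by have [_ ->] := negl_lead u0 (eq_ind_r (negl ^~ u) nDu D).
have vD : negl v (x - y).
  apply: ndom_negl => Dv; apply: ny => //; apply/lam_eq => //; split=> //.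
  apply: nnegl_dom => nDv; apply: nl; split=> //.
  by have [_ ->] := negl_lead v0 (neglC (eq_ind_r (negl ^~ v) nDv D)).
by apply: (@negl_irrefl _ _ std _ (x - y)); rewrite -{1}D; exact: neglB.
Qed.

(** Equal coefficients cannot both be the default 0, since x or y has a term at this class; so the
    common value c is a genuine term of both. If c were not the leading coefficient d of x - y, then
    y would have the two coefficients c and c - d there. *)
Lemma coef_differ x y : x - y != 0 ->
  coef x (lam (x - y)) != coef y (lam (x - y)).
Proof.
move=> D0; apply/eqP => cxy; have d0 := leading_coef_neq0 D0.
have D0' : y - x != 0 by rewrite -opprB oppr_eq0.
have lD : lam (y - x) = lam (x - y).
  apply/lam_eq; [exact: D0'|exact: D0|rewrite -(opprB x y)].
  by split; [apply: domN|apply: domNr]; exact: dom_refl.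
have [c [ox oy]] : exists c, occurs x (lam (x - y)) c /\ occurs y (lam (x - y)) c.
  have [c o] := occurs_exists D0; exists c.
  have c0 : c != 0 by case: o => o; exact: occurs_neq0 o.
  have cE : coef x (lam (x - y)) = c.
    by case: o => o; [exact: coefP o|exact: etrans cxy (coefP o)].
  have cE' : coef y (lam (x - y)) = c := etrans (esym cxy) cE.
  have := @coef_occurs x (lam (x - y)); rewrite cE => /(_ c0) ox.
  by have := @coef_occurs y (lam (x - y)); rewrite cE' => /(_ c0) oy; split.
have sub_neq (d : R) : d != 0 -> c <> c - d.
  by move=> d_neq0 /eqP; rewrite -subr_eq0 subKr (negPf d_neq0).
have cd : c = leading_coef prec (x - y).
  case: (occurs_shift D0 ox) => [e|o]; first exact: e.
  by case: (sub_neq _ d0 (occurs_unique oy o)).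
have cd' : c = leading_coef prec (y - x).
  rewrite -lD in oy, ox; case: (occurs_shift D0' oy) => [e|o]; first exact: e.
  by case: (sub_neq _ (leading_coef_neq0 D0') (occurs_unique ox o)).
have : leading_coef prec (y - x) = - leading_coef prec (x - y).
  have [a0 h k] := repP D0; rewrite leading_coefE lD; apply: stdpart_negl.
  by rewrite leading_coefE; exact/negl_swap/negl_stdpart.
rewrite -cd -cd' => /eqP; rewrite -addr_eq0 -mulr2n mulrn_eq0 /= cd.
by rewrite (negPf d0).
Qed.

End Stages.

(** * Distances in the plane *)

Import numFieldNormedType.Exports.

Section RealBounds.
Context {R : realType}.
Implicit Types r s t u : R.
Local Notation cosh := (@Defs.cosh R).
Local Notation sinh := (@Defs.sinh R).

Lemma sin_mvt u : 0 <= u -> exists2 v, 0 <= v <= u & sin u = cos v * u.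
Proof.
rewrite le_eqVlt => /predU1P[<-|u0].
  by exists 0; rewrite ?lexx // sin0 mulr0.
have cs : {within `[0, u], continuous (@sin R)}.
  by apply/continuous_subspaceT => ?; exact: continuous_sin.
have [v] := MVT u0 (fun x _ => is_derive_sin x) cs.
rewrite sin0 !subr0 in_itv /= => /andP[v0 vu] e; exists v => //.
by rewrite !ltW.
Qed.

Lemma sin_sqr_le u : sin u ^+ 2 <= u ^+ 2.
Proof.
wlog u0 : u / 0 <= u => [H|].
  have [/H//|/ltW u0] := leP 0 u.
  by rewrite -[leLHS]sqrrN -[leRHS]sqrrN -sinN; apply: H; rewrite oppr_ge0.
by have [v _ ->] := sin_mvt u0; rewrite exprMn ler_piMl ?sqr_ge0.
Qed.

(** Since u may exceed pi / 2, where the mean value theorem on [0, u] could give a negative cosine,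
    it is applied to u / 2: sin u = u cos v cos (u / 2) with v <= u / 2, and both cosines are at
    least cos (b / 2). *)
Lemma sin_ge b u : 0 <= u <= b -> b < pi -> u * cos (b / 2) ^+ 2 <= sin u.
Proof.
move=> /andP[u0 ub] bpi; have p0 := @pi_gt0 R.
have c0 : 0 <= cos (b / 2) by apply: cos_ge0_pihalf; apply/andP; split; lra.
have cge v : 0 <= v <= u / 2 -> cos (b / 2) <= cos v.
  move=> /andP[v0 vu]; have [->//|vb] := eqVneq v (b / 2).
  have {}vb : v < b / 2 by rewrite lt_neqAle vb /=; lra.
  by apply: ltW; rewrite ltr_cos // in_itv /=; apply/andP; split; lra.
have u2 : 0 <= u / 2 by lra.
have [v vu e] := sin_mvt u2.
have su : sin u = 2 * (cos (u / 2) * (cos v * (u / 2))).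
  have {1}-> : u = (u / 2) *+ 2 by rewrite mulr2n; lra.
  by rewrite sin_mulr2n mulr2n e; lra.
have h : cos (b / 2) * cos (b / 2) <= cos v * cos (u / 2).
  by apply: ler_pM => //; apply: cge; rewrite ?u2 /=.
by rewrite su expr2; have := ler_wpM2l u0 h; lra.
Qed.

Lemma coshN t : cosh (- t) = cosh t.
Proof. by rewrite /cosh opprK addrC. Qed.

Lemma cosh_norm t : cosh `|t| = cosh t.
Proof. by case: (ger0P t) => // _; exact: coshN. Qed.

Lemma cosh_ge_expR t : expR t <= 2 * cosh t.
Proof. by rewrite /cosh; have := expR_gt0 (- t); lra. Qed.

Lemma cosh_le_expR t : 0 <= t -> cosh t <= expR t.
Proof.
move=> t0; have : expR (- t) <= expR t by rewrite ler_expR; lra.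
by rewrite /cosh; lra.
Qed.

Lemma cosh_ge1 t : 1 <= cosh t.
Proof.
rewrite /cosh; have := expRxMexpNx_1 t; have := expR_gt0 t; have := expR_gt0 (- t).
move: (expR t) (expR (- t)) => a b b0 a0 ab.
by have := sqr_ge0 (a - b); rewrite expr2; nra.
Qed.

Lemma sinh_ge0 t : 0 <= t -> 0 <= sinh t.
Proof.
move=> t0; rewrite /sinh; have : expR (- t) <= expR t by rewrite ler_expR; lra.
lra.
Qed.

Lemma sinh_le_expR t : sinh t <= expR t / 2.
Proof. by rewrite /sinh; have := expR_gt0 (- t); lra. Qed.

Lemma sinh_ge_expR t : 1 <= t -> expR t / 4 <= sinh t.
Proof.
move=> t1; rewrite /sinh.
have h1 : 2 <= expR 1 :> R by have := expR_ge1Dx (1 : R); lra.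
have h2 : expR 1 <= expR t by rewrite ler_expR.
have h3 : expR t * expR (- t) = 1 by exact: expRxMexpNx_1.
have h4 := expR_gt0 (- t); nra.
Qed.

Lemma cosh_le_inv s t : 0 <= s -> 0 <= t -> cosh s <= cosh t -> s <= t.
Proof.
move=> s0 t0; rewrite /cosh => h; rewrite leNgt; apply/negP => ts.
have : 1 <= expR t by rewrite -expR0 ler_expR.
have : expR t < expR s by rewrite ltr_expR.
have := expRxMexpNx_1 t; have := expRxMexpNx_1 s.
have := expR_gt0 (- t); have := expR_gt0 (- s); move: h.
move: (expR t) (expR (- t)) (expR s) (expR (- s)) => a b c d h d0 b0 cd ab ac a1.
(* exp(-t) - exp(-s) is exp(s) - exp(t) times a factor below 1, so passing from t to s the
   decreasing exponential loses less than the increasing one gains. *)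
have bd : b - d = (c - a) * (b * d).
  have -> : (c - a) * (b * d) = (c * d) * b - (a * b) * d by ring.
  by rewrite cd ab; ring.
have bd1 : b * d < 1 by nra.
nra.
Qed.

Lemma cosh_surj c : 1 <= c -> exists2 d, 0 <= d & cosh d = c.
Proof.
move=> c1; have c2 : 0 <= c ^+ 2 - 1 by rewrite expr2; nra.
pose w := c + Num.sqrt (c ^+ 2 - 1).
have sq := sqr_sqrtr c2; have s0 := sqrtr_ge0 (c ^+ 2 - 1).
have w1 : 1 <= w by rewrite /w; lra.
exists (ln w); first exact: ln_ge0.
rewrite /cosh expRN lnK ?posrE; last by lra.
have -> : w^-1 = c - Num.sqrt (c ^+ 2 - 1).
  have w0 : w != 0 by rewrite gt_eqF; lra.
  apply: (mulfI w0); rewrite divff // /w [RHS]mulrC -subr_sqr sq; lra.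
by rewrite /w; lra.
Qed.

Local Notation dist := (@lobachevsky_dist R).

(** In this form both summands are nonnegative and can be bounded separately. Their sum is at least
    1, hence the hyperbolic cosine of some d, and the default value of [xget] is never taken. *)
Lemma distP r1 t1 r2 t2 : 0 <= r1 -> 0 <= r2 ->
  0 <= dist r1 t1 r2 t2 /\ cosh (dist r1 t1 r2 t2) =
    cosh (r1 - r2) + 2 * (sinh r1 * sinh r2 * sin ((t1 - t2) / 2) ^+ 2).
Proof.
move=> r10 r20.
have -> : cosh (r1 - r2) + 2 * (sinh r1 * sinh r2 * sin ((t1 - t2) / 2) ^+ 2) =
    cosh r1 * cosh r2 - sinh r1 * sinh r2 * cos (t1 - t2).
  have -> : cos (t1 - t2) = 1 - 2 * sin ((t1 - t2) / 2) ^+ 2.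
    have {1}-> : t1 - t2 = ((t1 - t2) / 2) *+ 2 by rewrite mulr2n; lra.
    by rewrite cos_mulr2n cos2sin2 mulr2n; lra.
  have -> : cosh (r1 - r2) = cosh r1 * cosh r2 - sinh r1 * sinh r2.
    by rewrite /cosh /sinh opprB !expRD; lra.
  by rewrite mulrBr; lra.
rewrite /lobachevsky_dist; case: xgetP => [d _ []//|none].
have [|d d0 dE] := @cosh_surj
  (cosh r1 * cosh r2 - sinh r1 * sinh r2 * cos (t1 - t2)); last by case: (none d).
have := cosh_ge1 (r1 - r2).
have -> : cosh (r1 - r2) = cosh r1 * cosh r2 - sinh r1 * sinh r2.
  by rewrite /cosh /sinh opprB !expRD; lra.
have s12 : 0 <= sinh r1 * sinh r2 by rewrite mulr_ge0 ?sinh_ge0.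
have := ler_wpM2l s12 (cos_le1 (t1 - t2)); lra.
Qed.

Section Bounds.
Variables r1 t1 r2 t2 : R.
Hypotheses (r1_ge0 : 0 <= r1) (r2_ge0 : 0 <= r2).
Local Notation d := (dist r1 t1 r2 t2).

Lemma dist_ge_radii : `|r1 - r2| <= d.
Proof.
have [d0 dE] := distP t1 t2 r1_ge0 r2_ge0.
apply: cosh_le_inv => //; rewrite cosh_norm dE lerDl.
rewrite mulr_ge0 // mulr_ge0 ?sqr_ge0 // mulr_ge0 //; exact: sinh_ge0.
Qed.

Lemma dist_le s t : `|t1 - t2| <= expR (- t) -> `|r1 - r2| <= s ->
  r1 + r2 - 2 * t <= s -> d <= s + 2.
Proof.
move=> Dt rs ts; have [d0 dE] := distP t1 t2 r1_ge0 r2_ge0.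
rewrite -ler_expR expRD; apply: le_trans (cosh_ge_expR _) _.
(* The additive constant 2: exp d <= 2 cosh d <= 2 exp s + exp s, and 3 <= 4 <= exp 2. *)
have e2 : 4 <= expR 2 :> R.
  have := expR_ge1Dx (1 : R); have -> : (2 : R) = 1 + 1 by lra.
  by rewrite expRD; nra.
have h1 : cosh (r1 - r2) <= expR s.
  by rewrite -cosh_norm (le_trans (cosh_le_expR _)) // ler_expR.
have h2 : sin ((t1 - t2) / 2) ^+ 2 <= expR (- t) ^+ 2.
  apply: le_trans (sin_sqr_le _) _.
  have -> : ((t1 - t2) / 2) ^+ 2 = (`|t1 - t2| / 2) ^+ 2.
    by case: (ger0P (t1 - t2)) => // _; rewrite mulNr sqrrN.
  have := normr_ge0 (t1 - t2); move: Dt.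
  by move: `|t1 - t2| (expR (- t)) => x y xy x0; rewrite !expr2; nra.
have h3 : sinh r1 * sinh r2 <= (expR r1 / 2) * (expR r2 / 2).
  by rewrite ler_pM ?sinh_ge0 ?sinh_le_expR.
have h4 : sinh r1 * sinh r2 * sin ((t1 - t2) / 2) ^+ 2 <=
    (expR r1 / 2) * (expR r2 / 2) * expR (- t) ^+ 2.
  by apply: ler_pM h3 h2; [rewrite mulr_ge0 ?sinh_ge0|exact: sqr_ge0].
have h5 : expR r1 * expR r2 * expR (- t) ^+ 2 <= expR s.
  by rewrite expr2 -!expRD ler_expR; lra.
have h6 := ler_wpM2l (expR_ge0 s) e2.
by rewrite dE; have := expR_gt0 s; lra.
Qed.

End Bounds.

(** The bound b < 2 pi keeps |t1 - t2| / 2 away from pi, the second zero of the sine. As in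
    [dist_le], the variable t replaces the logarithm of |t1 - t2|, so that the estimate transfers as
    a plain inequality. *)
Lemma dist_ge b : 0 <= b -> b < 2 * pi -> exists C, forall r1 t1 r2 t2 t,
  0 <= r1 -> 0 <= r2 -> `|t1 - t2| <= b -> expR (- t) <= `|t1 - t2| ->
  r1 + r2 - 2 * t <= dist r1 t1 r2 t2 + C.
Proof.
move=> b0 bpi; have p0 := @pi_gt0 R.
pose k := cos (b / 2 / 2) ^+ 2.
have k0 : 0 < k by rewrite exprn_gt0 // cos_gt0_pihalf //; apply/andP; split; lra.
(* The two hyperbolic sines cost a factor 4 each and the squared half angle a factor 4, that is 64,
   which the factor 2 in [distP] reduces to 32. [sin_ge] contributes k twice. *)
pose C := ln (32 / k ^+ 2).
exists (`|C| + 2 + 2 * b) => r1 t1 r2 t2 t r10 r20 Db tD.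
have CC : C <= `|C| by exact: ler_norm.
have C0 : 0 <= `|C| by exact: normr_ge0.
have [d0 dE] := distP t1 t2 r10 r20.
have := dist_ge_radii t1 t2 r10 r20; set d := dist r1 t1 r2 t2 in d0 dE *.
rewrite ler_norml => /andP[dr1 dr2].
have tb : - t <= b by have := expR_ge1Dx (- t); lra.
(* For a radius below 1 the bound on [sinh] fails, but then r1 + r2 <= |r1 - r2| + 2 <= d + 2, and -
   2 t <= 2 b: this is the term 2 + 2 b. *)
have [r11|r11] := leP 1 r1; last by lra.
have [r21|r21] := leP 1 r2; last by lra.
suff : expR (r1 + r2 - 2 * t) <= expR (d + C) by rewrite ler_expR; lra.
have k20 : 0 < k ^+ 2 by rewrite exprn_gt0.
have q0 : 0 < 32 / k ^+ 2 by rewrite divr_gt0.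
rewrite [in leRHS]expRD lnK ?posrE // mulrA ler_pdivlMr //.
have -> : expR (r1 + r2 - 2 * t) = expR r1 * expR r2 * expR (- t) ^+ 2.
  by rewrite expr2 -!expRD; congr expR; lra.
have sin_norm : sin ((t1 - t2) / 2) ^+ 2 = sin (`|t1 - t2| / 2) ^+ 2.
  by case: (ger0P (t1 - t2)) => // _; rewrite mulNr sinN sqrrN.
have kt : 0 <= expR (- t) / 2 * k by rewrite mulr_ge0 ?divr_ge0 ?expR_ge0 ?ltW.
have tk : expR (- t) / 2 * k <= sin (`|t1 - t2| / 2).
  have h : `|t1 - t2| / 2 * k <= sin (`|t1 - t2| / 2).
    apply: sin_ge; last by lra.
    by apply/andP; split; have := normr_ge0 (t1 - t2); lra.
  by apply: le_trans h; rewrite ler_pM2r //; lra.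
have h2 : (expR (- t) / 2 * k) ^+ 2 <= sin ((t1 - t2) / 2) ^+ 2.
  by rewrite sin_norm !expr2 ler_pM.
have h3 : (expR r1 / 4) * (expR r2 / 4) <= sinh r1 * sinh r2.
  by rewrite ler_pM ?sinh_ge_expR // divr_ge0 ?expR_ge0.
have h4 : (expR r1 / 4) * (expR r2 / 4) * (expR (- t) / 2 * k) ^+ 2 <=
    sinh r1 * sinh r2 * sin ((t1 - t2) / 2) ^+ 2.
  by apply: ler_pM h3 h2; [rewrite mulr_ge0 ?divr_ge0 ?expR_ge0|exact: sqr_ge0].
have h5 := cosh_le_expR d0; have h6 := cosh_ge1 (r1 - r2).
move: h4; rewrite !exprMn exprVn; lra.
Qed.

End RealBounds.

(** * The valuation - eps log |z| and the rescaled distance *)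

Class exp_embedding (R : realType) (F : realFieldType) (std : R -> F)
    (exp log : F -> F) := {
  exp_emb : order_embedding std;
  exp_add : forall x y, exp (x + y) = exp x * exp y;
  exp_pos : forall x, 0 < exp x;
  exp_ge : forall x, 1 + x <= exp x;
  exp_std : forall a, exp (std a) = std (expR a);
  exp_log : forall x, 0 < x -> exp (log x) = x }.
#[export] Existing Instance exp_emb.

Section Valuation.
Context {R : realType} {F : realFieldType} {std : R -> F} {exp log : F -> F}.
Context {expe : exp_embedding std exp log}.
Variable eps : F.
Hypotheses (eps_gt0 : 0 < eps) (eps_inf : infml std eps).
Implicit Types x y z w : F.
Local Notation dom := (dom std).
Local Notation negl := (negl std).
Local Notation fin := (fin std).
Local Notation infml := (infml std).

Definition val z := - (eps * log `|z|).

Lemma exp0 : exp 0 = 1.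
Proof. by rewrite -(emb0 (std := std)) exp_std expR0 emb1. Qed.

Lemma expN x : exp (- x) = (exp x)^-1.
Proof.
have x0 : exp x != 0 by rewrite gt_eqF // exp_pos.
by apply: (mulfI x0); rewrite -exp_add subrr exp0 divff.
Qed.

Lemma exp_lt x y : x < y -> exp x < exp y.
Proof.
move=> xy; rewrite -(subrK x y) exp_add -[ltLHS]mul1r ltr_pM2r ?exp_pos //.
by apply: lt_le_trans (exp_ge _); rewrite ltrDl subr_gt0.
Qed.

Lemma exp_le x y : (exp x <= exp y) = (x <= y).
Proof.
apply/idP/idP => [|].
  by apply: contraTT; rewrite -!ltNge => /exp_lt.
by rewrite le_eqVlt => /predU1P[->//|/exp_lt/ltW].
Qed.

Lemma exp_inj x y : exp x = exp y -> x = y.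
Proof. by move=> xy; apply/eqP; rewrite eq_le -(exp_le x y) -(exp_le y x) xy lexx. Qed.

Lemma normE z : z != 0 -> `|z| = exp (- val z / eps).
Proof.
move=> z0; rewrite /val opprK [eps * _]mulrC mulfK ?gt_eqF //.
by rewrite exp_log // normr_gt0.
Qed.

Lemma val_exp x : val (exp x) = - (eps * x).
Proof.
rewrite /val; congr (- (eps * _)); apply: exp_inj.
by rewrite exp_log ger0_norm ?ltW ?exp_pos.
Qed.

Lemma val1 : val 1 = 0.
Proof. by rewrite -exp0 val_exp mulr0 oppr0. Qed.

Lemma eps_small (c eta : R) : 0 < eta -> eps * std c < std eta.
Proof.
move=> eta0; have [c0|c0] := leP c 0.
  have sc0 : std c <= 0 by rewrite -(emb0 (std := std)) emb_le.
  have se0 : 0 < std eta by rewrite emb_gt0.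
  by apply: le_lt_trans se0; rewrite mulr_ge0_le0 // ltW.
case: eps_inf => /(_ (eta / c)); rewrite divr_gt0 // gtr0_norm // => /(_ isT) h.
have -> : eta = (eta / c) * c by rewrite divfK // gt_eqF.
by rewrite embM ltr_pM2r // emb_gt0.
Qed.

(** Since exp x >= 1 + x, exp (eta / eps) exceeds every standard number. A standard gap between two
    values of [val] therefore means that one number is negligible against the other. *)
Lemma exp_eps_small (eta de : R) : 0 < eta -> 0 < de ->
  exp (- (std eta / eps)) < std de.
Proof.
move=> eta0 de0; rewrite expN -[std de]invrK.
rewrite ltf_pV2 ?posrE ?exp_pos ?invr_gt0 ?emb_gt0 //.
apply: lt_le_trans (exp_ge _); rewrite -embV; apply: (@lt_le_trans _ _ (std eta / eps)).
  by rewrite ltr_pdivlMr // mulrC eps_small.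
by rewrite lerDr.
Qed.

Lemma negl_val (eta : R) w z : z != 0 -> w != 0 -> 0 < eta ->
  std eta <= val w - val z -> negl w z.
Proof.
move=> z0 w0 eta0 h; split=> de de0; rewrite !normE //.
have -> : - val w / eps = - ((val w - val z) / eps) + - val z / eps by ring.
rewrite exp_add ltr_pM2r ?exp_pos //.
apply: le_lt_trans (exp_eps_small eta0 de0).
by rewrite exp_le lerN2 ler_pM2r // invr_gt0.
Qed.

(** A standard factor K shifts [val] by eps ln K, which is infinitesimal and so is absorbed by any
    margin eta. *)
Lemma dom_val (eta : R) w z : w != 0 -> z != 0 -> dom w z -> 0 < eta ->
  val z - std eta <= val w.
Proof.
move=> w0 z0 /dom_pos[K K0]; rewrite !normE // => h eta0.
have {h} : exp (- val w / eps) <= exp (std (ln K) + - val z / eps).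
  by rewrite exp_add exp_std lnK ?posrE.
rewrite exp_le ler_pdivrMr // mulrDl divfK ?gt_eqF // => h.
by have := eps_small (ln K) eta0; rewrite [eps * _]mulrC; lra.
Qed.

Lemma val_dom_inf w z : w != 0 -> z != 0 -> dom w z -> dom z w ->
  infml (val w - val z).
Proof.
move=> w0 z0 wz zw; split=> eta eta0; have e2 : 0 < eta / 2 by lra.
have h1 := dom_val w0 z0 wz e2; have h2 := dom_val z0 w0 zw e2.
have h3 : std (eta / 2) < std eta by rewrite emb_lt; lra.
by rewrite ltr_norml; apply/andP; split; lra.
Qed.

Lemma st_val_negl (q : R) w z : z != 0 -> w != 0 -> fin (val z) ->
  stdpart std (val z) < q -> std q <= val w -> negl w z.
Proof.
move=> z0 w0 zf; set p := stdpart _ _ => pq qw.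
have e0 : 0 < (q - p) / 2 by lra.
apply: (negl_val z0 w0 e0).
have : val z < std (p + (q - p) / 2) by apply: stdpart_lt => //; rewrite -/p; lra.
have qE : q = p + (q - p) / 2 + (q - p) / 2 by lra.
by move: qw; rewrite [X in std X <= _]qE embD; lra.
Qed.

Section Distance.
Variables (r1 r2 D d : F) (m : R).
Local Notation s1 := (stdpart std (eps * r1)).
Local Notation s2 := (stdpart std (eps * r2)).
Hypotheses (fin1 : fin (eps * r1)) (fin2 : fin (eps * r2)).
Hypothesis d_ge_radii : `|r1 - r2| <= d.
Hypothesis d_le : forall s t, `|D| <= exp (- t) -> `|r1 - r2| <= s ->
  r1 + r2 - 2 * t <= s -> d <= s + 2.
Hypothesis d_ge : exists C : R, forall t, exp (- t) <= `|D| ->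
  r1 + r2 - 2 * t <= d + std C.
(** m plays the role of the minimum of s1, s2 and the standard part of [val D]. It is described by
    inequalities with margins because D may be 0 and [val D] may be infinite, in which case there is
    no such standard part. *)
Hypotheses (m1 : m <= s1) (m2 : m <= s2).
Hypothesis D_small : forall eta : R, 0 < eta -> D = 0 \/ std (m - eta) <= val D.
Hypothesis m_sharp : [\/ m = s1, m = s2 |
  D != 0 /\ forall eta : R, 0 < eta -> val D <= std (m + eta)].

Let approx x (eta : R) : fin x -> 0 < eta ->
  std (stdpart std x) - std eta < x /\ x < std (stdpart std x) + std eta.
Proof.
move=> xf eta0; rewrite -embB -embD; split.
  by apply: stdpart_gt => //; lra.
by apply: stdpart_lt => //; lra.
Qed.

Let epsK x : eps * (x / eps) = x.
Proof. by rewrite mulrC divfK // gt_eqF. Qed.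

Lemma dist_upper (eta : R) : 0 < eta ->
  eps * d <= std (s1 + s2 - 2 * m + 5 * eta).
Proof.
move=> eta0.
(* Each radius contributes one eta and t = (m - eta) / eps contributes two; the fifth eta absorbs
   eps * 2. *)
pose S := std (s1 + s2 - 2 * m + 4 * eta).
have [a1 b1] := approx fin1 eta0; have [a2 b2] := approx fin2 eta0.
have E0 : 0 < std eta by rewrite emb_gt0.
have M1 : std m <= std s1 by rewrite emb_le.
have M2 : std m <= std s2 by rewrite emb_le.
have SE : S = std s1 + std s2 - 2 * std m + 4 * std eta.
  by rewrite /S embD embB embD !embM !(emb_nat (std := std)).
have d1 : d <= S / eps + 2.
  apply: (d_le (t := std (m - eta) / eps)).
  - have [->|D0] := eqVneq D 0; first by rewrite normr0 ltW // exp_pos.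
    rewrite normE // exp_le mulNr lerN2 ler_pM2r ?invr_gt0 //.
    by have [/eqP|//] := D_small eta0; rewrite (negPf D0).
  - rewrite ler_pdivlMr // mulrC -[eps in X in X <= _]gtr0_norm // -normrM mulrBr.
    by rewrite ler_norml SE; apply/andP; split; lra.
  - rewrite ler_pdivlMr // mulrC mulrBr mulrDr mulrCA epsK embB SE; lra.
have := ler_wpM2l (ltW eps_gt0) d1; rewrite mulrDr epsK => h.
have : eps * std 2 < std eta by exact: eps_small.
rewrite (emb_nat (std := std)) => h2.
have -> : s1 + s2 - 2 * m + 5 * eta = s1 + s2 - 2 * m + 4 * eta + eta by lra.
by rewrite embD -/S; lra.
Qed.

(** If m is s1 or s2, the target s1 + s2 - 2 m is a difference of radii up to sign and the radial
    bound suffices. Otherwise [d_ge] is used with t = (m + eta) / eps, and the fifth eta absorbs eps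
    * C. *)
Lemma dist_lower (eta : R) : 0 < eta ->
  std (s1 + s2 - 2 * m - 5 * eta) <= eps * d.
Proof.
move=> eta0.
have [a1 b1] := approx fin1 eta0; have [a2 b2] := approx fin2 eta0.
have E0 : 0 < std eta by rewrite emb_gt0.
have -> : std (s1 + s2 - 2 * m - 5 * eta) =
    std s1 + std s2 - 2 * std m - 5 * std eta.
  by rewrite !embB embD !embM !(emb_nat (std := std)).
have := ler_wpM2l (ltW eps_gt0) d_ge_radii.
rewrite -[eps in X in X <= _ -> _]gtr0_norm // -normrM mulrBr ler_norml.
move=> /andP[h1 h2].
case: m_sharp => [->|->|[D0 Dm]]; [lra|lra|].
have [C dC] := d_ge.
have := dC (std (m + eta) / eps).
rewrite normE // exp_le mulNr lerN2 ler_pM2r ?invr_gt0 // => /(_ (Dm _ eta0)) h.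
have := ler_wpM2l (ltW eps_gt0) h.
rewrite mulrBr mulrDr [X in _ - X]mulrCA epsK mulrDr embD.
by have := eps_small C eta0; lra.
Qed.

Lemma stdpart_dist : fin (eps * d) /\ stdpart std (eps * d) = s1 + s2 - 2 * m.
Proof.
have h : infml (eps * d - std (s1 + s2 - 2 * m)).
  split=> e e0; have e6 : 0 < e / 6 by lra.
  have := dist_upper e6; have := dist_lower e6.
  have : std (5 * (e / 6)) < std e by rewrite emb_lt; lra.
  rewrite [std (_ - 5 * _)]embB [std (_ + 5 * _)]embD => h1 h2 h3.
  by rewrite ltr_norml; apply/andP; split; lra.
split; last exact: stdpart_unique.
rewrite -(subrK (std (s1 + s2 - 2 * m)) (eps * d)).
by apply: finD; [exact: infml_fin|exact: fin_std].
Qed.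

End Distance.
End Valuation.

(** * Transferred distance estimates and representatives of angles *)

Section Transferred.
Context {R : realType} {M : nonstandard_model R}.
Local Notation hR := (hyperreal M).
Local Notation std := (hstd M).
Local Notation transfer phi := (@rtransfer R M phi).
Local Notation Dist := (RFun4 (@lobachevsky_dist R)).
Implicit Types r s t x y : hR.

Definition hyperdist r1 t1 r2 t2 : hR := hfun4 (@lobachevsky_dist R) r1 t1 r2 t2.

#[export] Instance hexp_embedding : exp_embedding std (@hexp R M) hlog := {
  exp_emb := hstd_embedding; exp_add := hexpD; exp_pos := hexp_gt0;
  exp_ge := hexp_ge1Dx; exp_std := hexp_std; exp_log := hlogK }.

Lemma hdist_ge_radii r1 t1 r2 t2 : 0 <= r1 -> 0 <= r2 ->
  `|r1 - r2| <= hyperdist r1 t1 r2 t2.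
Proof.
move=> /hleE h1 /hleE h2; apply/hleE; move: r1 t1 r2 t2 h1 h2.
apply: (transfer (RAll (RAll (RAll (RAll (RImp (Le (RCst 0) v3) (RImp
  (Le (RCst 0) v1) (Le (Abs (Add v3 (Opp v1))) (Dist v3 v2 v1 v0))))))))).
by move=> r1 t1 r2 t2 /=; exact: dist_ge_radii.
Qed.

Lemma hdist_le r1 t1 r2 t2 s t : 0 <= r1 -> 0 <= r2 ->
  `|t1 - t2| <= hexp (- t) -> `|r1 - r2| <= s -> r1 + r2 - 2 * t <= s ->
  hyperdist r1 t1 r2 t2 <= s + 2.
Proof.
have -> : 2 = std 2 :> hR by rewrite (emb_nat (std := std)).
move=> /hleE h1 /hleE h2 /hleE h3 /hleE h4 /hleE h5; apply/hleE.
move: r1 t1 r2 t2 s t h1 h2 h3 h4 h5.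
apply: (transfer (RAll (RAll (RAll (RAll (RAll (RAll
  (RImp (Le (RCst 0) v5) (RImp (Le (RCst 0) v3)
  (RImp (Le (Abs (Add v4 (Opp v2))) (Exp (Opp v0)))
  (RImp (Le (Abs (Add v5 (Opp v3))) v1)
  (RImp (Le (Add (Add v5 v3) (Opp (Mul (RCst 2) v0))) v1)
  (Le (Dist v5 v4 v3 v2) (Add v1 (RCst 2))))))))))))))).
by move=> r1 t1 r2 t2 s t /= h1 h2 h3 h4 h5; exact: dist_le h3 h4 h5.
Qed.

(** C is fixed before the transfer, so it remains a standard real and eps * C is infinitesimal. *)
Lemma hdist_ge (b : R) : 0 <= b -> b < 2 * pi -> exists C : R,
  forall r1 t1 r2 t2 t, 0 <= r1 -> 0 <= r2 -> `|t1 - t2| <= std b ->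
  hexp (- t) <= `|t1 - t2| -> r1 + r2 - 2 * t <= hyperdist r1 t1 r2 t2 + std C.
Proof.
move=> b0 /(dist_ge b0)[C dC]; exists C => r1 t1 r2 t2 t.
have -> : 2 = std 2 :> hR by rewrite (emb_nat (std := std)).
move=> /hleE h1 /hleE h2 /hleE h3 /hleE h4; apply/hleE.
move: r1 t1 r2 t2 t h1 h2 h3 h4.
apply: (transfer (RAll (RAll (RAll (RAll (RAll
  (RImp (Le (RCst 0) v4) (RImp (Le (RCst 0) v2)
  (RImp (Le (Abs (Add v3 (Opp v1))) (RCst b))
  (RImp (Le (Exp (Opp v0)) (Abs (Add v3 (Opp v1))))
  (Le (Add (Add v4 v2) (Opp (Mul (RCst 2) v0)))
    (Add (Dist v4 v3 v2 v1) (RCst C))))))))))))).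
exact: dC.
Qed.

Lemma std_angleP (phi : hcircle M) :
  fin std (std_angle phi) /\ 0 <= stdpart std (std_angle phi) < 2 * pi.
Proof.
suff [y yP] : exists y, [/\ coset_of phi y, hfinite y & 0 <= st y < 2 * pi].
  rewrite /std_angle; case: xgetP => [z _ [_ /hfiniteE zf]|/(_ y)//].
  by rewrite stE.
have [x ->] := coset_ofP phi; have [k [kZ /andP[y0 y2]]] := hfloor_2pi x.
pose y := x - std (2 * pi) * k.
have yf : fin std y.
  apply: fin_le (fin_std (std := std) (2 * pi)).
  by rewrite !ger0_norm ?(le_trans y0) // ltW.
have sy0 : 0 <= stdpart std y by exact: stdpart_ge.
have sy2 : stdpart std y <= 2 * pi by apply: stdpart_le => //; exact: ltW.
(* A representative in [0, 2 pi) can be infinitely close to 2 pi; one more turn then gives it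
   standard part 0. *)
have [sy|sy] := eqVneq (stdpart std y) (2 * pi); last first.
  exists y; split; last 1 first.
  - by rewrite stE sy0 lt_neqAle sy sy2.
  - by exists (- k); [exact: hintN|rewrite /y -mulrN].
  - exact/hfiniteE.
exists (y - std (2 * pi)); split.
- exists (- (k + 1)); first exact/hintN/hintD1.
  have -> : hadd x (hmul (std (2 * pi)) (- (k + 1))) =
    x + std (2 * pi) * - (k + 1) by [].
  by rewrite /y; ring.
- by apply/hfiniteE/finB => //; exact: fin_std.
- rewrite stE stdpartB //; last exact: fin_std.
  rewrite stdpart_std sy subrr lexx /=; have := @pi_gt0 R; lra.
Qed.

Lemma hdist_ge_sep r1 t1 r2 t2 : 0 <= r1 -> 0 <= r2 ->
  fin std t1 -> fin std t2 ->
  0 <= stdpart std t1 -> stdpart std t1 < 2 * pi ->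
  0 <= stdpart std t2 -> stdpart std t2 < 2 * pi ->
  exists C : R, forall t, hexp (- t) <= `|t1 - t2| ->
    r1 + r2 - 2 * t <= hyperdist r1 t1 r2 t2 + std C.
Proof.
move=> r1_ge0 r2_ge0 f1 f2.
have Df : fin std (t1 - t2) by exact: finB.
have : stdpart std (t1 - t2) = stdpart std t1 - stdpart std t2 by exact: stdpartB.
move: (stdpart std t1) (stdpart std t2) => a b Dab a0 a2 b0 b2.
have n2 : `|a - b| < 2 * pi by rewrite ltr_norml; apply/andP; split; lra.
have n0 := normr_ge0 (a - b); have n1 := ler_norm (a - b).
have n3 : - (a - b) <= `|a - b| by rewrite -normrN ler_norm.
move: (`|a - b|) n0 n1 n2 n3 => n n0 n1 n2 n3.
(* The midpoint between |st D| and 2 pi is a standard bound for |D| that is still below 2 pi. *)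
have [||C HC] := @hdist_ge ((n + 2 * pi) / 2); [lra|lra|].
exists C => t tD; apply: (HC r1 t1 r2 t2 t r1_ge0 r2_ge0 _ tD).
rewrite ler_norml -hstdN; apply/andP; split; apply/ltW.
  by apply: (stdpart_gt Df); rewrite Dab; lra.
by apply: (stdpart_lt Df); rewrite Dab; lra.
Qed.

End Transferred.

(** * The gap between two angles *)

Section Main.
Context {R : realType} {M : nonstandard_model R} {prec : rel (hyperreal M)}.
Hypothesis prec_wo : wochoice.well_order prec.
Variable eps : hyperreal M.
Hypotheses (eps_gt0 : 0 < eps) (eps_inf : infml (hstd M) eps).
Local Notation hR := (hyperreal M).
Local Notation std := (hstd M).
Local Notation val := (val (log := @hlog R M) eps).
Local Notation fin := (fin std).
Local Notation dom := (dom std).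
Local Notation negl := (negl std).
Implicit Types x y z w : hR.

(** Any element of the class may replace the chosen representative, as [val] changes by an
    infinitesimal inside a class. *)
Lemma g_lam z : z != 0 -> g prec eps (lam z) =
  if `[< fin (val z) >] then (stdpart std (val z))%:E else +oo%E.
Proof.
move=> z0; have [a0 h k] := repP prec_wo z0.
have vi := val_dom_inf (expe := hexp_embedding) eps_gt0 eps_inf a0 z0 k h.
have -> : g prec eps (lam z) = if `[< hfinite (val (rep_of prec (lam z))) >]
  then (st (val (rep_of prec (lam z))))%:E else +oo%E by [].
move: (val (rep_of prec (lam z))) (val z) vi => u v uv.
have -> : `[< hfinite u >] = `[< fin v >].
  apply: asbool_equiv_eq; split=> [/hfiniteE uf|vf].
    by rewrite -(subKr u v); exact: finB uf (infml_fin uv).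
  by apply/hfiniteE; rewrite -(subrK v u); exact: finD (infml_fin uv) vf.
case: asboolP => // vf; rewrite stE -[u in LHS](subrK v u) (stdpartD (infml_fin uv) vf).
by rewrite (stdpart_infml uv) add0r.
Qed.

Lemma lam_leE x y : x != 0 -> y != 0 -> lam_le (lam x) (lam y) <-> dom x y.
Proof.
move=> x0 y0; split=> [[/(lam_eq x0 y0)[]//|/(lam_ltE x0 y0)/negl_dom]//|xy].
have [xy'|] := pselect (negl x y); first by right; apply/lam_ltE.
by move=> /nnegl_dom yx; left; apply/lam_eq.
Qed.

Let valE := hexp_embedding (M := M).
Let g_val_fin (z : hR) (h : R) : z != 0 -> (g prec eps (lam z) < h%:E)%E ->
  fin (val z) /\ stdpart std (val z) < h.
Proof. by move=> z0; rewrite (g_lam z0); case: asboolP => // zf; rewrite lte_fin. Qed.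

Let hexp_pt (r : R) : val (hexp (- (std r / eps))) = std r.
Proof.
rewrite (val_exp (expe := valE)) mulrN opprK.
by rewrite [eps * _]mulrC divfK // gt_eqF.
Qed.

Section Points.
Variables (r1 r2 x y : hR) (m : R).
Local Notation w1 := (hexp (- r1)).
Local Notation w2 := (hexp (- r2)).
Local Notation s1 := (stdpart std (eps * r1)).
Local Notation s2 := (stdpart std (eps * r2)).
Local Notation D := (x - y).
Hypotheses (r1_ge0 : 0 <= r1) (r2_ge0 : 0 <= r2).
Hypotheses (fin1 : fin (eps * r1)) (fin2 : fin (eps * r2)).
Hypothesis D_fin : fin D.
Hypotheses (m1 : m <= s1) (m2 : m <= s2).
Hypothesis D_small : forall eta : R, 0 < eta -> D = 0 \/ std (m - eta) <= val D.
Hypothesis m_sharp : [\/ m = s1, m = s2 |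
  D != 0 /\ forall eta : R, 0 < eta -> val D <= std (m + eta)].

Let w_neq0 r : hexp (- r) != 0 :> hR.
Proof. by rewrite gt_eqF // hexp_gt0. Qed.

Let val_w r : val (hexp (- r)) = eps * r.
Proof. by rewrite (val_exp (expe := valE)) mulrN opprK. Qed.

Let dom_w r z : z != 0 -> fin (eps * r) -> fin (val z) ->
  stdpart std (val z) < stdpart std (eps * r) -> dom (hexp (- r)) z.
Proof.
move=> z0 rf zf zr.
have [q q1 q2] : exists2 q, stdpart std (val z) < q & q < stdpart std (eps * r).
  move: zr; move: (stdpart _ _) (stdpart _ _) => a b ab.
  by exists ((a + b) / 2); lra.
apply/negl_dom/(st_val_negl (expe := valE) eps_gt0 eps_inf z0 (w_neq0 r) zf q1).
apply: (eq_ind_r (fun u => std q <= u) _ (val_w r)).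
exact/ltW/(stdpart_gt rf).
Qed.

(** A class of z with g < m has a value separated by a standard gap from those of exp (- r1), exp (-
    r2) and a nonzero D. All of these are negligible against z, so both functions are defined there
    and [coef_close] applies. *)
Lemma agree_below (h : R) : h <= m -> forall l : set hR, Lambda l ->
  lam_le l lam0 -> (g prec eps l < h%:E)%E ->
  [/\ lam_le (lam w1) l, lam_le (lam w2) l & coef prec x l = coef prec y l].
Proof.
move=> hm l [z /eqP z0 ->] _ /(g_val_fin z0)[zf zh].
have zm := lt_le_trans zh hm.
split; first by apply/(lam_leE (w_neq0 r1) z0)/(dom_w z0 fin1 zf (lt_le_trans zm m1)).
  by apply/(lam_leE (w_neq0 r2) z0)/(dom_w z0 fin2 zf (lt_le_trans zm m2)).
apply: (coef_close prec_wo z0).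
have [eta eta0 zeta] : exists2 eta, 0 < eta & stdpart std (val z) < m - eta.
  by move: zm; move: (stdpart _ _) => a am; exists ((m - a) / 2); lra.
have [->|D0] := eqVneq D 0; first exact: negl0.
have [/eqP|Dm] := D_small eta0; first by rewrite (negPf D0).
exact: (st_val_negl (expe := valE) eps_gt0 eps_inf z0 D0 zf zeta Dm).
Qed.

Let far_point (r : hR) (h : R) : 0 <= r -> fin (eps * r) ->
    stdpart std (eps * r) < h ->
  exists2 l : set hR, Lambda l & [/\ lam_le l lam0, (g prec eps l < h%:E)%E &
    ~ lam_le (lam (hexp (- r))) l].
Proof.
move=> r0 rf; move sE : (stdpart _ _) => s rh.
have s0 : 0 <= s.
  by rewrite -sE; apply: stdpart_ge => //; rewrite (emb0 (std := std)) mulr_ge0 // ltW.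
(* The class with value q lies below that of exp (- r), as q > s, and still has g < h. It is at most
   lambda^0 because q > 0. *)
pose q := s + (h - s) / 2; pose z := hexp (- (std q / eps)).
have z0 : z != 0 by rewrite gt_eqF // hexp_gt0.
have zE : val z = std q by exact: hexp_pt.
exists (lam z); first by exists z => //; exact/eqP.
split.
- apply/(lam_leE z0 (oner_neq0 _))/negl_dom.
  apply: (negl_val (expe := valE) eps_gt0 eps_inf (eta := q) (oner_neq0 _) z0).
    by rewrite /q; lra.
  by rewrite zE (val1 (expe := valE)) subr0.
- rewrite g_lam // zE; case: asboolP => [_|[]]; last exact: fin_std.
  by rewrite stdpart_std lte_fin /q; lra.
- move=> /(lam_leE (w_neq0 r) z0) wz.
  have eta0 : 0 < (h - s) / 4 by lra.
  have := dom_val (expe := valE) eps_gt0 eps_inf (w_neq0 r) z0 wz eta0.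
  rewrite val_w zE -embB => /(stdpart_ge rf); rewrite sE /q; lra.
Qed.

(** The obstruction above m depends on what m is: if it comes from a radius, the domain of one
    function ends; otherwise the class of D itself separates the two angles. *)
Lemma disagree_above (h : R) : (forall l : set hR, Lambda l ->
    lam_le l lam0 -> (g prec eps l < h%:E)%E ->
    [/\ lam_le (lam w1) l, lam_le (lam w2) l & coef prec x l = coef prec y l]) ->
  h <= m.
Proof.
move=> H; rewrite leNgt; apply/negP => mh.
case: m_sharp => [ms|ms|[D0 Dm]].
- have [|l Ll [l0 lh nl]] := @far_point r1 h r1_ge0 fin1; first by rewrite -ms.
  by have [h1 _ _] := H l Ll l0 lh; exact: nl h1.
- have [|l Ll [l0 lh nl]] := @far_point r2 h r2_ge0 fin2; first by rewrite -ms.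
  by have [_ h2 _] := H l Ll l0 lh; exact: nl h2.
have D1 : dom D 1.
  by apply/(domE _ (oner_neq0 _)); rewrite divr1; exact: D_fin.
have [_ _ /eqP] : [/\ lam_le (lam w1) (lam D), lam_le (lam w2) (lam D) &
    coef prec x (lam D) = coef prec y (lam D)].
  apply: H; first by exists D => //; exact/eqP.
    exact/(lam_leE D0 (oner_neq0 _)).
  (* Bounded below because D is finite, and above because m is sharp. *)
  have Df : fin (val D).
    have := dom_val (expe := valE) eps_gt0 eps_inf D0 (oner_neq0 _) D1 ltr01.
    rewrite (val1 (expe := valE)) sub0r => Dge.
    exists (`|m| + 2); rewrite ltr_norml -hstdN; apply/andP; split.
      by apply: lt_le_trans Dge; rewrite -hstdN emb_lt; have := normr_ge0 m; lra.
    apply: le_lt_trans (Dm 1 ltr01) _; rewrite emb_lt.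
    by have := ler_norm m; lra.
  rewrite (g_lam D0); case: asboolP => // _; rewrite lte_fin.
  have eta0 : 0 < (h - m) / 2 by lra.
  by apply: le_lt_trans (stdpart_le Df (Dm _ eta0)) _; lra.
by apply/negP; exact: coef_differ.
Qed.

Lemma g_tildeE : g_tilde prec eps (coef prec x) (lam w1) (coef prec y) (lam w2) =
  m%:E.
Proof.
rewrite /g_tilde; set S := [set h : R | _].
have SE : S = [set h | h <= m].
  apply/seteqP; split=> h; [exact: disagree_above|exact: agree_below].
rewrite SE; apply/eqP; rewrite eq_le; apply/andP; split.
  by apply: ge_ereal_sup => _ [h hm <-]; rewrite lee_fin.
by apply: ereal_sup_ubound; exists m => //=.
Qed.

Lemma g_w r : fin (eps * r) ->
  g prec eps (lam (hexp (- r))) = (stdpart std (eps * r))%:E.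
Proof.
by move=> rf; rewrite (g_lam (w_neq0 r)) val_w; case: asboolP.
Qed.

End Points.
(** If D = 0 or [val D] reaches c = min(a, b) up to every margin, then m = c, and [val D] may well
    be infinite. Otherwise D is nonzero and [val D] lies below c by a standard amount; being also
    bounded below, it is finite and m is its standard part. *)
Lemma separation_value (D : hR) (a b : R) : fin D -> exists m,
  [/\ m <= a, m <= b,
      forall eta : R, 0 < eta -> D = 0 \/ std (m - eta) <= val D &
      [\/ m = a, m = b |
        D != 0 /\ forall eta : R, 0 < eta -> val D <= std (m + eta)]].
Proof.
move=> D_fin; pose c := Num.min a b.
have ca : c <= a by rewrite ge_min lexx.
have cb : c <= b by rewrite ge_min lexx orbT.
have [H|] := pselect (forall eta : R, 0 < eta -> D = 0 \/ std (c - eta) <= val D).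
  exists c; split=> //; rewrite /c; case: (leP a b) => _; first exact: Or31.
  exact: Or32.
move=> /existsNP[e /not_implyP[e0 /not_orP[/eqP D0 /negP]]].
rewrite -ltNge => Dc.
have D1 : dom D 1 by apply/(domE _ (oner_neq0 _)); rewrite divr1.
have Df : fin (val D).
  have := dom_val (expe := valE) eps_gt0 eps_inf D0 (oner_neq0 _) D1 ltr01.
  rewrite (val1 (expe := valE)) sub0r => Dge.
  exists (`|c| + 2); rewrite ltr_norml -hstdN; apply/andP; split.
    by apply: lt_le_trans Dge; rewrite -hstdN emb_lt; have := normr_ge0 c; lra.
  by apply: lt_trans Dc _; rewrite emb_lt; have := ler_norm c; lra.
have sc : stdpart std (val D) <= c - e by apply: stdpart_le => //; exact: ltW.
exists (stdpart std (val D)); split; [lra|lra|move=> eta eta0; right|apply: Or33].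
  by apply/ltW/stdpart_gt => //; lra.
by split=> // eta eta0; apply/ltW/stdpart_lt => //; lra.
Qed.

End Main.

Theorem theorem4p1 (R : realType) (M : nonstandard_model R)
  (prec : rel (hyperreal M)) (prec_wo : initial_well_order prec)
  (eps : hyperreal M) (eps_gt0 : hlt hzero eps) (eps_inf : infinitesimal eps)
  (x1 x2 : hplane M) (Yx1 : finite_part eps x1) (Yx2 : finite_part eps x2) :
  let l1 := lam (hexp (hopp (hradius x1))) in
  let l2 := lam (hexp (hopp (hradius x2))) in
  hfinite (hmul eps (hdist x1 x2)) /\
  (st (hmul eps (hdist x1 x2)))%:E =
  delta prec eps (circle_coef prec (hangle x1)) l1
                 (circle_coef prec (hangle x2)) l2.
Proof.
move=> l1 l2; have [wo _] := prec_wo.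
move: eps_gt0 => /hltE e0; move: eps_inf => /infinitesimalE ei.
move: Yx1 Yx2; rewrite /finite_part => /hfiniteE f1 /hfiniteE f2.
have [/hleE r1_ge0 /hleE r2_ge0] := (hradius_ge0 x1, hradius_ge0 x2).
have [af1 /andP[ax0 ax2]] := std_angleP (hangle x1).
have [af2 /andP[ay0 ay2]] := std_angleP (hangle x2).
rewrite /circle_coef.
have -> : hdist x1 x2 = hyperdist (hradius x1) (std_angle (hangle x1))
  (hradius x2) (std_angle (hangle x2)) by [].
move: (hradius x1) (hradius x2) (std_angle (hangle x1)) (std_angle (hangle x2))
  r1_ge0 r2_ge0 f1 f2 af1 af2 ax0 ax2 ay0 ay2 @l1 @l2
  => r1 r2 x y r1_ge0 r2_ge0 f1 f2 xf yf x0 x2' y0 y2 l1 l2.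
have Df : fin (hstd M) (x - y) by exact: finB.
have [m [m1 m2 Ds ms]] := separation_value e0 ei
  (stdpart (hstd M) (eps * r1)) (stdpart (hstd M) (eps * r2)) Df.
have [df dE] := @stdpart_dist R _ (hstd M) (@hexp R M) hlog _ eps e0 ei
  r1 r2 (x - y) (hyperdist r1 x r2 y) m f1 f2 (hdist_ge_radii x y r1_ge0 r2_ge0)
  (fun s t => @hdist_le R M r1 x r2 y s t r1_ge0 r2_ge0)
  (hdist_ge_sep r1_ge0 r2_ge0 xf yf x0 x2' y0 y2) m1 m2 Ds ms.
split; first exact/hfiniteE.
have gt := g_tildeE wo e0 ei r1_ge0 r2_ge0 f1 f2 Df m1 m2 Ds ms.
have g1 := g_w wo e0 ei f1; have g2 := g_w wo e0 ei f2.
have add_gaps (A B G : \bar R) (a b : R) : A = a%:E -> B = b%:E -> G = m%:E ->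
    ((A - G) + (B - G))%E = (a + b - 2 * m)%:E.
  by move=> -> -> ->; rewrite -!EFinB -EFinD; congr EFin; lra.
rewrite stE dE; exact: esym (add_gaps _ _ _ _ _ g1 g2 gt).
Qed.
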